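(* Let $0<r_1<r_2$, let $\Omega=\{r_1<r<r_2\}\subset\mathbb{R}^2$ be an annulus ($r$ the distance to the origin), let $g,q,b,z_d\in\mathbb{R}$, and for $\alpha>0$ let $u,p,u_\alpha,p_\alpha$ be the states and adjoint states defined in the context. Then $u_\alpha$ converges to $u$ and $p_\alpha$ converges to $p$ when $\alpha\to\infty$. Furthermore, there exists a positive constant $K_2=K_2(r_1,r_2,g,q)$ such that $$\|u_{\alpha}-u\|_{H^1(\Omega)}=\|u_{\alpha}-u\|_{L^2(\Omega)}=\frac{K_2}{\alpha},\qquad\text{where } K_2=\frac{\sqrt{\pi} \left(r_2^2-r_1^2\right)^{1/2} \left|2 q r_2- g \left(r_2^2-r_1^2\right)\right|}{2 r_1},$$ and there exists a positive constant $L_2=L_2(r_1,r_2,g,q,b,z_d)$ such that $$\lim_{\alpha\to\infty} \alpha\, \|p_{\alpha}-p\|_{L^2(\Omega)} =L_2.$$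
   Context: $\Gamma_1=\{r=r_1\}$, $\Gamma_2=\{r=r_2\}$; $\partial/\partial n$ is the outward normal derivative. The following are the unique solutions of the respective mixed problems: $u$: $-\Delta u=g$ in $\Omega$, $u|_{\Gamma_1}=b$, $-\frac{\partial u}{\partial n}|_{\Gamma_2}=q$; $p$: $-\Delta p=u-z_d$ in $\Omega$, $p|_{\Gamma_1}=0$, $\frac{\partial p}{\partial n}|_{\Gamma_2}=0$; $u_\alpha$: $-\Delta u_\alpha=g$ in $\Omega$, $-\frac{\partial u_\alpha}{\partial n}|_{\Gamma_1}=\alpha(u_\alpha-b)$, $-\frac{\partial u_\alpha}{\partial n}|_{\Gamma_2}=q$; $p_\alpha$: $-\Delta p_\alpha=u_\alpha-z_d$ in $\Omega$, $-\frac{\partial p_\alpha}{\partial n}|_{\Gamma_1}=\alpha p_\alpha$, $\frac{\partial p_\alpha}{\partial n}|_{\Gamma_2}=0$. $\|v\|_{H^1(\Omega)}^2=\|v\|_{L^2(\Omega)}^2+\|\nabla v\|_{L^2(\Omega)}^2$.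
   Formalization: ''Positive'' fails in degenerate cases (g=q=0 gives K_2=0; also b=z_d gives L_2=0); proved instead: K_2, L_2 are nonnegative, both positive if 2qr_2 differs from g(r_2^2-r_1^2), and L_2>0 exactly when p_α differs from p for some α. *)

(* Defs.v *)
From HB Require Import structures.
From mathcomp Require Import all_boot all_order all_algebra.
From mathcomp Require Import all_classical all_reals all_analysis.

Set Implicit Arguments.
Unset Strict Implicit.
Unset Printing Implicit Defensive.

Import Order.TTheory GRing.Theory Num.Theory.
Import numFieldNormedType.Exports.

Local Open Scope classical_set_scope.
Local Open Scope ring_scope.

Section Annulus.
Context {R : realType}.

(* The library norm on R * R is the max norm, hence this explicit definition. *)
Definition enorm (x : R * R) : R := Num.sqrt (x.1 ^+ 2 + x.2 ^+ 2).

Definition circle (rho : R) : set (R * R) := [set x | enorm x = rho].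

Definition annulus (r1 r2 : R) : set (R * R) := [set x | r1 < enorm x < r2].

Definition closed_annulus (r1 r2 : R) : set (R * R) :=
  [set x | r1 <= enorm x <= r2].

Definition e1 : R * R := (1, 0).
Definition e2 : R * R := (0, 1).

Definition grad (v : R * R -> R) (x : R * R) : R * R := ('D_e1 v x, 'D_e2 v x).

Definition laplacian (v : R * R -> R) (x : R * R) : R :=
  'D_e1 ('D_e1 v) x + 'D_e2 ('D_e2 v) x.

(* For open A: all partial derivatives of order at most 2 exist on A and are
   continuous there.  Continuity of [v] and of its first partial derivatives
   follows from the second clause (existence and continuity of the next-order
   partial derivatives), so only the top order is required to be continuous. *)
Definition C2_on (A : set (R * R)) (v : R * R -> R) : Prop :=
  forall x i j, A x -> i \in [:: e1; e2] -> j \in [:: e1; e2] ->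
    [/\ derivable v x i, derivable ('D_i v) x j &
        {for x, continuous ('D_j ('D_i v))}].

(* One-sided derivative at the boundary point [x] along the outward unit
   vector [n], computed from inside the domain. *)
Definition normal_derivative (v : R * R -> R) (x n : R * R) (l : R) : Prop :=
  (fun h : R => h^-1 * (v (x + h *: n) - v x)) @ (0 : R)^'- --> l.

(* Unit normals pointing out of the annulus: on the inner circle, towards the
   origin. *)
Definition normal_inner_circle (r1 : R) (x : R * R) : R * R := - (r1^-1 *: x).
Definition normal_outer_circle (r2 : R) (x : R * R) : R * R := r2^-1 *: x.

(* Classical solutions: C^2 inside, continuous up to the boundary. *)
Definition poisson (r1 r2 : R) (f v : R * R -> R) : Prop :=
  [/\ C2_on (annulus r1 r2) v,
      {within closed_annulus r1 r2, continuous v} &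
      forall x, annulus r1 r2 x -> - laplacian v x = f x].

(* Condition  - dv/dn = flux  on the outer circle. *)
Definition outer_flux (r2 flux : R) (v : R * R -> R) : Prop :=
  forall x, circle r2 x ->
    normal_derivative v x (normal_outer_circle r2 x) (- flux).

(* Condition  v = c  on the inner circle. *)
Definition inner_dirichlet (r1 c : R) (v : R * R -> R) : Prop :=
  forall x, circle r1 x -> v x = c.

(* Condition  - dv/dn = alpha (v - c)  on the inner circle. *)
Definition inner_robin (r1 alpha c : R) (v : R * R -> R) : Prop :=
  forall x, circle r1 x ->
    normal_derivative v x (normal_inner_circle r1 x)
      (- (alpha * (v x - c))).

Definition state (r1 r2 g q b : R) (u : R * R -> R) : Prop :=
  [/\ poisson r1 r2 (fun=> g) u, inner_dirichlet r1 b u & outer_flux r2 q u].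

Definition adjoint (r1 r2 zd : R) (u p : R * R -> R) : Prop :=
  [/\ poisson r1 r2 (fun x => u x - zd) p, inner_dirichlet r1 0 p &
      outer_flux r2 0 p].

Definition state_robin (r1 r2 g q b alpha : R) (u : R * R -> R) : Prop :=
  [/\ poisson r1 r2 (fun=> g) u, inner_robin r1 alpha b u & outer_flux r2 q u].

Definition adjoint_robin (r1 r2 zd alpha : R) (u p : R * R -> R) : Prop :=
  [/\ poisson r1 r2 (fun x => u x - zd) p, inner_robin r1 alpha 0 p &
      outer_flux r2 0 p].

Definition lebesgue2 := ((@lebesgue_measure R) \x (@lebesgue_measure R))%E.

(* Extended-real valued, so that an infinite norm is not collapsed to 0. *)
Definition L2norm (A : set (R * R)) (v : R * R -> R) : \bar R :=
  'N[lebesgue2]_(2%:E) [(EFin \o v) \_ A]%E.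

Definition H1norm (A : set (R * R)) (v : R * R -> R) : \bar R :=
  ((L2norm A v ^+ 2 + L2norm A (enorm \o grad v) ^+ 2) `^ (2^-1))%E.

End Annulus.

(* Main.v *)
Require Import Defs.
From HB Require Import structures.
From mathcomp Require Import all_boot all_order all_algebra.
From mathcomp Require Import all_classical all_reals all_analysis.
From mathcomp Require Import measurable_realfun ring lra.

Set Implicit Arguments.
Unset Strict Implicit.
Unset Printing Implicit Defensive.

Import Order.TTheory GRing.Theory Num.Theory.
Import numFieldNormedType.Exports.

Local Open Scope classical_set_scope.
Local Open Scope ring_scope.

(** Every solution is radial and explicit, so the theorem reduces to uniqueness
    for the mixed problems and to integrals of radial functions.

    Write [s] for the squared distance to the origin.  A radial function [F(s)]
    has Laplacian [4 (s F'' + F')], so the span of [1], [ln s], [s], [s^2] and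
    [s ln s] contains solutions [U] and [P] of the two Dirichlet problems, and
    the torsion function [T], with [- Laplacian T = 1], zero on the inner circle
    and flat on the outer one.  Let [A], [B], [C] be the derivatives at
    [r = r1] of [U], [P], [T].  The Robin condition is satisfied by adding
    [A / alpha] to [U]; this changes the source of the adjoint problem by the
    constant [A / alpha], hence
      [pa - p = (A T + B + A C / alpha) / alpha].
    Thus [ua - u] is a constant, its gradient vanishes, and its norm is
    [|A| / alpha] times the square root of the area of the annulus, while
    [alpha] times the norm of [pa - p] tends to the norm [L2] of [A T + B].
    If [L2] is zero, then [A T + B] vanishes on the annulus; its Laplacian is
    [- A], so [A] and then [B] are zero and [pa = p] for all [alpha].

    That classical solutions agree with the explicit ones ([mixed_radial]) is a
    maximum principle ([mixed_le0]).  A harmonic [w] with homogeneous data is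
    perturbed by a strictly superharmonic radial barrier that increases
    with [r]; the maximum of the difference is then neither interior nor on the
    outer circle, and on the inner circle the condition bounds it by
    [O(eps)].  One-sided normal derivatives suffice, because at a boundary
    maximum only their sign matters.

    The area of the annulus ([lebesgue2_annulus]) is a difference of two disks,
    whose slices are integrated with an explicit primitive. *)

(** * Directional derivatives *)

Definition sqn {R : realType} (x : R * R) : R := x.1 ^+ 2 + x.2 ^+ 2.

Definition dot {R : realType} (x y : R * R) : R := x.1 * y.1 + x.2 * y.2.

Section Directional.
Context {R : realType}.
Implicit Types (f : R * R -> R) (x v : R * R) (t : R).

(** Reduces every directional derivative to one real variable. *)
Lemma growth_rate_line f x v t :
  (fun h : R => h^-1 *: ((f \o shift (t *: v + x)) (h *: v)
             - f (t *: v + x))) =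
  (fun h : R => h^-1 *: (((fun s : R => f (s *: v + x)) \o shift t)
             (h *: (1 : R)) - f (t *: v + x))).
Proof. by apply/funext => h /=; rewrite addrA -scalerDl [_%:A]mulr1. Qed.

Lemma derive_line f x v t :
  'D_v f (t *: v + x) = 'D_1 (fun s : R => f (s *: v + x)) t.
Proof. by rewrite /derive growth_rate_line. Qed.

Lemma is_derive_line f x v t d :
  is_derive (t *: v + x) v f d <->
  is_derive t 1 (fun s : R => f (s *: v + x)) d.
Proof.
have E := growth_rate_line f x v t.
split=> -[ex val]; split.
- by rewrite /derivable -E.
- by rewrite -val derive_line.
- by rewrite /derivable E.
- by rewrite -val derive_line.
Qed.

Lemma is_derive_at f x v d :
  is_derive x v f d <-> is_derive (0 : R) 1 (fun s : R => f (s *: v + x)) d.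
Proof.
rewrite -is_derive_line (_ : 0 *: v + x = x) //.
by rewrite scale0r add0r.
Qed.

Lemma is_derive_chain f (F : R -> R) x v d d' :
  is_derive x v f d -> is_derive (f x) 1 F d' ->
  is_derive x v (F \o f) (d' * d).
Proof.
move=> /is_derive_at df dF; apply/is_derive_at.
apply: (@is_derive1_comp _ F (fun s : R => f (s *: v + x))).
by rewrite /= scale0r add0r.
Qed.

Lemma is_derive_dot x v w : is_derive x v (dot ^~ w) (dot v w).
Proof.
apply/is_derive_at.
rewrite (_ : (fun s : R => _) = (fun s : R => s * dot v w + dot x w)); last first.
  by apply/funext => s; rewrite /dot /= /GRing.scale /=; ring.
apply: is_derive_eq; rewrite /GRing.scale /=; ring.
Qed.

Lemma is_derive_sqn x v : is_derive x v sqn (2 * dot x v).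
Proof.
apply/is_derive_at.
rewrite (_ : (fun s : R => _) =
    (fun s : R => s * (s * sqn v) + (s * (2 * dot x v) + sqn x))); last first.
  by apply/funext => s; rewrite /dot /sqn /= /GRing.scale /=; ring.
apply: is_derive_eq; rewrite /GRing.scale /=; ring.
Qed.

Lemma sqn_continuous : continuous (@sqn R).
Proof.
move=> x; apply: cvgD.
- apply: (@cvg_comp _ _ _ fst (fun t : R => t ^+ 2) _ (nbhs x.1)); first exact: cvg_fst.
  exact: exprn_continuous.
- apply: (@cvg_comp _ _ _ snd (fun t : R => t ^+ 2) _ (nbhs x.2)); first exact: cvg_snd.
  exact: exprn_continuous.
Qed.

End Directional.

(** * Laplacians on open sets and radial functions *)

Section Regularity.
Context {R : realType}.
Implicit Types (A : set (R * R)) (v : R * R -> R) (x i : R * R).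

(** The part of [C2_on] that the second-derivative test needs. *)
Definition twice_derivable A v :=
  forall x i, A x -> i \in [:: e1; e2] ->
    derivable v x i /\ derivable ('D_i v) x i.

Lemma C2_on_twice_derivable A v : C2_on A v -> twice_derivable A v.
Proof. by move=> Cv x i Ax ie; have [] := Cv x i i Ax ie ie. Qed.

Lemma near_open A x (P : R * R -> Prop) : open A -> A x ->
  (forall y, A y -> P y) -> \forall y \near x, P y.
Proof. by move=> oA Ax AP; apply: filterS (open_nbhs_nbhs (conj oA Ax)). Qed.

(** Second derivatives only see first derivatives near the point, so openness
    is what lets the difference be taken pointwise. *)
Lemma derive2B A v w x i : open A -> twice_derivable A v ->
    twice_derivable A w -> A x -> i \in [:: e1; e2] ->
  is_derive x i ('D_i (v \- w)) ('D_i ('D_i v) x - 'D_i ('D_i w) x).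
Proof.
move=> oA dv dw Ax ie.
apply: (@near_eq_is_derive _ _ _ ('D_i v - 'D_i w)).
  apply: near_open Ax _ => // y Ay.
  have [vy _] := dv y i Ay ie; have [wy _] := dw y i Ay ie.
  by rewrite (deriveB vy wy).
have [_ vx] := dv x i Ax ie; have [_ wx] := dw x i Ax ie.
split; [exact (derivableB vx wx)|exact (deriveB vx wx)].
Qed.

Lemma twice_derivableB A v w : open A -> twice_derivable A v ->
  twice_derivable A w -> twice_derivable A (v \- w).
Proof.
move=> oA dv dw x i Ax ie; split.
  have [vx _] := dv x i Ax ie; have [wx _] := dw x i Ax ie.
  exact (derivableB vx wx).
by have [] := derive2B oA dv dw Ax ie.
Qed.

Lemma laplacianB A v w x : open A -> twice_derivable A v ->
  twice_derivable A w -> A x ->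
  laplacian (v \- w) x = laplacian v x - laplacian w x.
Proof.
move=> oA dv dw Ax; rewrite /laplacian.
have [_ ->] : is_derive x e1 ('D_e1 (v \- w)) ('D_e1 ('D_e1 v) x - 'D_e1 ('D_e1 w) x).
  by apply: (derive2B oA) => //; rewrite inE eqxx.
have [_ ->] : is_derive x e2 ('D_e2 (v \- w)) ('D_e2 ('D_e2 v) x - 'D_e2 ('D_e2 w) x).
  by apply: (derive2B oA) => //; rewrite !inE eqxx orbT.
by rewrite opprD addrACA.
Qed.

Lemma eq_laplacian A v w x : open A -> A x -> (forall y, A y -> v y = w y) ->
  laplacian v x = laplacian w x.
Proof.
move=> oA Ax vw.
have D1 i y : A y -> 'D_i v y = 'D_i w y.
  by move=> Ay; apply: near_eq_derive; apply: (near_open oA Ay).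
have D2 i : 'D_i ('D_i v) x = 'D_i ('D_i w) x.
  by apply: near_eq_derive; apply: (near_open oA Ax) => y; exact: D1.
by rewrite /laplacian !D2.
Qed.

End Regularity.

Section Radial.
Context {R : realType}.
Implicit Types (F G : R -> R) (x : R * R) (s : R).

(** [F] is a function of the squared radius, with its first two derivatives.
    The squared radius is used because it is a polynomial in the
    coordinates. *)
Definition profile F F1 F2 := forall s, 0 < s ->
  is_derive s 1 F (F1 s) /\ is_derive s 1 F1 (F2 s).

Lemma profile_cst c : profile (fun=> c) (fun=> 0) (fun=> 0).
Proof. by move=> s s0; split; exact: is_derive_cst. Qed.

Lemma profileD F F1 F2 G G1 G2 : profile F F1 F2 -> profile G G1 G2 ->
  profile (F \+ G) (F1 \+ G1) (F2 \+ G2).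
Proof.
by move=> HF HG s s0; have [? ?] := HF s s0; have [? ?] := HG s s0;
  split; exact: is_deriveD.
Qed.

Lemma profileZ k F F1 F2 : profile F F1 F2 ->
  profile (k \*o F) (k \*o F1) (k \*o F2).
Proof.
by move=> HF s s0; have [? ?] := HF s s0; split; exact: is_deriveZ.
Qed.

Lemma open_sqn_gt0 : open [set x : R * R | 0 < sqn x].
Proof.
by apply: (@open_comp _ _ sqn [set t | 0 < t]) => [x _|];
  [exact: sqn_continuous|exact: open_gt].
Qed.

Section Fixed.
Variables (F F1 F2 : R -> R).
Hypothesis HF : profile F F1 F2.

Lemma is_derive_radial x v : 0 < sqn x ->
  is_derive x v (F \o sqn) (F1 (sqn x) * (2 * dot x v)).
Proof.
by move=> /HF[? _]; apply: is_derive_chain; first exact: is_derive_sqn.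
Qed.

Lemma is_derive2_radial x v : 0 < sqn x ->
  is_derive x v ('D_v (F \o sqn))
    (F2 (sqn x) * (2 * dot x v) ^+ 2 + F1 (sqn x) * (2 * dot v v)).
Proof.
move=> x0.
apply: (@near_eq_is_derive _ _ _ ((F1 \o sqn) * (fun y => 2 * dot y v))).
  apply: near_open open_sqn_gt0 x0 _ => y y0.
  by have [_ ->] := is_derive_radial v y0.
have d1 : is_derive x v (F1 \o sqn) (F2 (sqn x) * (2 * dot x v)).
  by have [_ ?] := HF x0; apply: is_derive_chain; first exact: is_derive_sqn.
have d2 : is_derive x v (fun y => 2 * dot y v) (2 * dot v v).
  by apply: is_deriveZ; exact: is_derive_dot.
by apply: is_derive_eq; rewrite /GRing.scale /=; ring.
Qed.

(** The terms [4 x_i^2 F''] sum to [4 s F''] and the terms [2 F'] to [4 F']. *)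
Lemma laplacian_radial x : 0 < sqn x ->
  laplacian (F \o sqn) x = 4 * (sqn x * F2 (sqn x) + F1 (sqn x)).
Proof.
move=> x0; rewrite /laplacian.
have [_ ->] := is_derive2_radial e1 x0; have [_ ->] := is_derive2_radial e2 x0.
by rewrite /dot /sqn /=; ring.
Qed.

Lemma twice_derivable_radial A : (forall x, A x -> 0 < sqn x) ->
  twice_derivable A (F \o sqn).
Proof.
move=> A0 x i /A0 x0 _; split.
  by have [] := is_derive_radial i x0.
by have [] := is_derive2_radial i x0.
Qed.

Lemma continuous_profile s : 0 < s -> {for s, continuous F}.
Proof.
by move=> /HF[[dF _] _]; apply/differentiable_continuous/derivable1_diffP.
Qed.

Lemma continuous_radial x : 0 < sqn x -> {for x, continuous (F \o sqn)}.
Proof.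
move=> x0; apply: continuous_comp; first exact: sqn_continuous.
exact: continuous_profile.
Qed.

End Fixed.

(** The radial functions whose Laplacian is an affine combination of [1],
    [sqn] and [ln \o sqn]; they contain all solutions met below. *)
Definition log_poly a0 a1 a2 a3 a4 (s : R) : R :=
  a0 + a1 * ln s + a2 * s + a3 * s ^+ 2 + a4 * (s * ln s).
Definition log_poly1 a1 a2 a3 a4 (s : R) : R :=
  a1 * s^-1 + a2 + 2 * a3 * s + a4 * (ln s + 1).
Definition log_poly2 a1 a3 a4 (s : R) : R :=
  - (a1 * s^-1 ^+ 2) + 2 * a3 + a4 * s^-1.

Lemma profile_log_poly a0 a1 a2 a3 a4 :
  profile (log_poly a0 a1 a2 a3 a4) (log_poly1 a1 a2 a3 a4) (log_poly2 a1 a3 a4).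
Proof.
move=> s s0; have dln := is_derive1_ln s0.
have sn0 : s != 0 by rewrite gt_eqF.
split.
  apply: is_derive_eq; rewrite /log_poly1 /GRing.scale /=.
  by field.
have dV : is_derive s 1 (fun t : R => t^-1) (- s^-1 ^+ 2).
  apply: (is_derive_eq (is_deriveV sn0 (is_derive_id s 1))).
  by rewrite /GRing.scale /= mulr1 exprVn.
apply: is_derive_eq; rewrite /log_poly2 /GRing.scale /=.
by field.
Qed.

Lemma log_poly_laplacian a1 a2 a3 a4 s : 0 < s ->
  4 * (s * log_poly2 a1 a3 a4 s + log_poly1 a1 a2 a3 a4 s) =
  4 * a2 + 16 * a3 * s + a4 * (4 * ln s + 8).
Proof. by move=> s0; rewrite /log_poly2 /log_poly1; field; rewrite gt_eqF. Qed.

End Radial.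

(** * Geometry of the annulus and normal derivatives *)

Section Geometry.
Context {R : realType}.
Implicit Types (x : R * R) (r s : R).

Lemma sqn_ge0 x : 0 <= sqn x.
Proof. by rewrite addr_ge0 ?sqr_ge0. Qed.

Lemma sqr_enorm x : enorm x ^+ 2 = sqn x.
Proof. by rewrite sqr_sqrtr ?sqn_ge0. Qed.

Lemma enormZ k x : enorm (k *: x) = `|k| * enorm x.
Proof.
rewrite /enorm -sqrtr_sqr -sqrtrM ?sqr_ge0 //; congr Num.sqrt.
by rewrite /= /GRing.scale /=; ring.
Qed.

Lemma enorm_continuous : continuous (@enorm R).
Proof.
by move=> x; apply: (@continuous_comp _ _ _ sqn Num.sqrt);
  [exact: sqn_continuous|exact: sqrt_continuous].
Qed.

Lemma circle_sqn r x : circle r x -> sqn x = r ^+ 2.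
Proof. by rewrite -sqr_enorm => ->. Qed.

Lemma annulus_sqn r1 r2 x : 0 < r1 -> annulus r1 r2 x ->
  r1 ^+ 2 < sqn x < r2 ^+ 2.
Proof.
rewrite -sqr_enorm /annulus /= => r0 /andP[r1x xr2].
have x0 := lt_trans r0 r1x.
by rewrite !ltr_pXn2r ?nnegrE ?r1x ?xr2 ?ltW // (lt_trans x0).
Qed.

Lemma sqn_annulus r1 r2 x : 0 < r1 -> r1 < r2 ->
  r1 ^+ 2 < sqn x < r2 ^+ 2 -> annulus r1 r2 x.
Proof.
rewrite -sqr_enorm /annulus /= => r0 r12.
have r20 := lt_trans r0 r12; have x0 : 0 <= enorm x by exact: sqrtr_ge0.
by rewrite !ltr_pXn2r ?nnegrE // ltW.
Qed.

Lemma closed_annulus_sqn_gt0 r1 r2 x : 0 < r1 -> closed_annulus r1 r2 x ->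
  0 < sqn x.
Proof.
by rewrite -sqr_enorm /closed_annulus /= => r0 /andP[/(lt_le_trans r0) ? _];
  apply: exprn_gt0.
Qed.

Lemma annulus_sub_closed r1 r2 : annulus r1 r2 `<=` closed_annulus r1 r2.
Proof. by move=> x /andP[? ?]; apply/andP; split; apply: ltW. Qed.

Lemma closed_annulus_cases r1 r2 x : closed_annulus r1 r2 x ->
  [\/ circle r1 x, annulus r1 r2 x | circle r2 x].
Proof.
rewrite /closed_annulus /annulus /circle /= !le_eqVlt.
move=> /andP[/orP[/eqP ->|h1] /orP[/eqP h2|h2]];
 by [constructor 1|constructor 3|constructor 2; rewrite h1].
Qed.

Lemma open_annulus r1 r2 : open (@annulus R r1 r2).
Proof.
rewrite (_ : annulus r1 r2 = enorm @^-1` `]r1, r2[%classic).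
  by apply: open_comp => [x _|]; [exact: enorm_continuous|exact: interval_open].
by apply/seteqP; split=> x; rewrite /annulus /= in_itv.
Qed.

Lemma norm_le_enorm x : `|x.1| <= enorm x /\ `|x.2| <= enorm x.
Proof.
split; rewrite /enorm -sqrtr_sqr; apply: ler_wsqrtr.
  by rewrite lerDl sqr_ge0.
by rewrite lerDr sqr_ge0.
Qed.

Lemma compact_closed_annulus r1 r2 : compact (@closed_annulus R r1 r2).
Proof.
apply: (@subclosed_compact _ _ (`[- r2, r2] `*` `[- r2, r2])).
- rewrite (_ : closed_annulus r1 r2 = enorm @^-1` `[r1, r2]%classic).
    apply: closed_comp => [x _|]; last exact: interval_closed.
    exact: enorm_continuous.
  by apply/seteqP; split=> x; rewrite /closed_annulus /= in_itv.
- by apply: compact_setX; apply: segment_compact.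
- move=> x /andP[_ xr2]; have [h1 h2] := norm_le_enorm x.
  by split; rewrite /= in_itv /= -ler_norml; apply: le_trans xr2.
Qed.

End Geometry.

Section NormalDerivative.
Context {R : realType}.
Implicit Types (v w : R * R -> R) (x n : R * R) (l r : R).

Lemma normal_derivativeB v w x n l l' : normal_derivative v x n l ->
  normal_derivative w x n l' -> normal_derivative (v \- w) x n (l - l').
Proof.
move=> dv dw; rewrite /normal_derivative.
rewrite (_ : (fun h : R => _) = (fun h : R => h^-1 * (v (x + h *: n) - v x))
    \- (fun h : R => h^-1 * (w (x + h *: n) - w x))).
  exact: cvgB.
by apply/funext => h /=; ring.
Qed.

(** The factor [k] is [1 / r2] on the outer circle and [- 1 / r1] on the inner
    one, so both normals are covered. *)
Lemma normal_derivative_radial F F1 F2 x k : profile F F1 F2 -> 0 < sqn x ->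
  normal_derivative (F \o sqn) x (k *: x) (F1 (sqn x) * (2 * k * sqn x)).
Proof.
move=> HF x0; have [dF vF] := is_derive_radial HF (k *: x) x0.
rewrite (_ : F1 _ * _ = 'D_(k *: x) (F \o sqn) x); last first.
  by rewrite vF /dot /sqn /= /GRing.scale /=; ring.
rewrite /normal_derivative.
have -> : (fun h : R => h^-1 * ((F \o sqn) (x + h *: (k *: x)) - (F \o sqn) x))
    = (fun h : R => h^-1 *: (((F \o sqn) \o shift x) (h *: (k *: x)) - (F \o sqn) x)).
  by apply/funext => h /=; rewrite (addrC x).
apply: cvg_trans dF; apply: cvg_app; apply: within_subset => h /=.
by move=> h0; rewrite lt_eqF.
Qed.

(** Backing off from a boundary maximum against the outward normal lowers the
    value, and the increment [h] is negative. *)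
Lemma normal_derivative_max v x n l : normal_derivative v x n l ->
  (\forall h \near (0 : R)^'-, v (x + h *: n) <= v x) -> 0 <= l.
Proof.
move=> dv vmax; apply: (cvgr_to_ge dv); near=> h.
have h0 : h < 0 by near: h; exact: nbhs_left_lt.
rewrite nmulr_rge0 ?invr_lt0 // subr_le0.
by near: h.
Unshelve. all: by end_near. Qed.

Lemma enorm_normal k x h : enorm (x + h *: (k *: x)) = `|1 + h * k| * enorm x.
Proof. by rewrite -enormZ scalerDl scale1r scalerA. Qed.

(** For small [h < 0] the point moves to distance [r2 + h] from the origin. *)
Lemma outer_normal_inside r1 r2 x : 0 < r1 -> r1 < r2 -> circle r2 x ->
  \forall h \near (0 : R)^'-,
    closed_annulus r1 r2 (x + h *: normal_outer_circle r2 x).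
Proof.
move=> r10 r12 xr2; near=> h.
have h0 : h < 0 by near: h; exact: nbhs_left_lt.
have hr : r1 - r2 < h by near: h; apply: nbhs_left_gt; rewrite subr_lt0.
have r20 := lt_trans r10 r12.
rewrite /closed_annulus /= enorm_normal xr2.
have -> : `|1 + h * r2^-1| * r2 = r2 + h.
  rewrite -[X in _ * X](gtr0_norm r20) -normrM mulrDl mul1r.
  by rewrite mulfVK ?gt_eqF // gtr0_norm //; lra.
lra.
Unshelve. all: by end_near. Qed.

(** For small [h < 0] the point moves to distance [r1 - h] from the origin. *)
Lemma inner_normal_inside r1 r2 x : 0 < r1 -> r1 < r2 -> circle r1 x ->
  \forall h \near (0 : R)^'-,
    closed_annulus r1 r2 (x + h *: normal_inner_circle r1 x).
Proof.
move=> r10 r12 xr1; near=> h.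
have h0 : h < 0 by near: h; exact: nbhs_left_lt.
have hr : r1 - r2 < h by near: h; apply: nbhs_left_gt; rewrite subr_lt0.
rewrite /closed_annulus /= /normal_inner_circle -scaleNr enorm_normal xr1.
have -> : `|1 + h * - r1^-1| * r1 = r1 - h.
  rewrite -[X in _ * X](gtr0_norm r10) -normrM mulrDl mul1r mulrN mulNr.
  by rewrite mulfVK ?gt_eqF // gtr0_norm // subr_gt0 (lt_trans h0).
lra.
Unshelve. all: by end_near. Qed.

End NormalDerivative.

(** * Maximum principle and uniqueness *)

Section MaximumPrinciple.
Context {R : realType}.
Implicit Types (v w : R * R -> R) (x i : R * R).

(** A positive second derivative at a critical point makes the first one
    positive just to its right, and the mean value theorem then exceeds the
    maximum. *)
Lemma second_derivative_test (f : R -> R) :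
  (\forall t \near (0 : R), derivable f t 1) -> derivable ('D_1 f) 0 1 ->
  (\forall t \near (0 : R), f t <= f 0) -> 'D_1 ('D_1 f) 0 <= 0.
Proof.
move=> df ddf fmax; rewrite leNgt; apply/negP => pos.
have [d0 d00 dd0] : exists2 d : R, 0 < d & forall t, `|t| < d ->
    derivable f t 1 /\ f t <= f 0.
  have /nbhs_ballP[d /= d0 Bd] : \forall t \near (0 : R),
    derivable f t 1 /\ f t <= f 0 by near=> t; split; near: t.
  exists d => // t td; apply: Bd.
  by rewrite /ball /= sub0r normrN.
(* The maximum makes [0] a critical point. *)
have D0 : 'D_1 f 0 = 0.
  have [_ ->] // : is_derive (0 : R) 1 f 0.
  apply: (@derive1_at_max _ _ (- d0) d0).
  - by lra.
  - by move=> t; rewrite in_itv /= -ltr_norml => /dd0[].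
  - by rewrite in_itv /= oppr_lt0 d00.
  - by move=> t; rewrite in_itv /= -ltr_norml => /dd0[].
have /nbhs_ballP[d1 /= d10 Bd1] : \forall h \near (0 : R), h != 0 ->
    0 < h^-1 *: (('D_1 f \o shift 0) (h *: 1) - 'D_1 f 0).
  exact: (cvgr_gt _ ddf).
(* [m] is a point where [f m > f 0], inside the neighbourhood where [0] is maximal. *)
pose m := Num.min d0 d1 / 2.
have m0 : 0 < m by rewrite divr_gt0 // lt_min d00.
have md0 : m < d0.
  by rewrite /m ltr_pdivrMr // (le_lt_trans (_ : _ <= d0)) ?ge_min ?lexx //; lra.
have md1 : m < d1.
  by rewrite /m ltr_pdivrMr // (le_lt_trans (_ : _ <= d1)) ?ge_min ?lexx ?orbT //; lra.
have df' t : t \in `]0, m[ -> is_derive t 1 f ('D_1 f t).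
  rewrite in_itv /= => /andP[t0 tm]; apply: derivableP.
  by have [] // := dd0 t; rewrite gtr0_norm // (lt_trans tm).
have cf : {within `[0, m], continuous f}.
  apply: derivable_within_continuous => t; rewrite in_itv /= => /andP[t0 tm].
  by have [] // := dd0 t; rewrite ger0_norm // (le_lt_trans tm).
have [c] := MVT m0 df' cf.
rewrite in_itv /= => /andP[c0 cm] E.
have Dc : 0 < 'D_1 f c.
  have := Bd1 c; rewrite /ball /= sub0r normrN gtr0_norm // (lt_trans cm) //.
  move=> /(_ isT); rewrite gt_eqF // => /(_ isT).
  by rewrite /GRing.scale /= mulr1 addr0 D0 subr0 pmulr_rgt0 // invr_gt0.
have md0' : `|m| < d0 by rewrite gtr0_norm.
have [_] := dd0 m md0'.
apply/negP; rewrite -ltNge -subr_gt0 E subr0.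
by rewrite mulr_gt0.
Unshelve. all: by end_near. Qed.

Lemma near_line (P : R * R -> Prop) x i : (\forall y \near x, P y) ->
  \forall t \near (0 : R), P (t *: i + x).
Proof.
move=> Px.
have : (fun t : R => t *: i + x) @ (0 : R) --> 0 *: i + x.
  apply: cvgD; last exact: cvg_cst.
  have h : id t @[t --> (0 : R)] --> (0 : R) by exact: cvg_id.
  exact: (cvgZ h (cvg_cst i)).
by rewrite scale0r add0r; exact.
Qed.

Lemma laplacian_at_max A v x : open A -> twice_derivable A v -> A x ->
  (forall y, A y -> v y <= v x) -> laplacian v x <= 0.
Proof.
move=> oA dv Ax vmax.
have D2 i : i \in [:: e1; e2] -> 'D_i ('D_i v) x <= 0.
  move=> ie.
  pose f (t : R) := v (t *: i + x).
  have f0 : f 0 = v x by rewrite /f scale0r add0r.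
  have D1 : (fun t : R => 'D_i v (t *: i + x)) = 'D_1 f.
    by apply/funext => t; exact: derive_line.
  have D2v : 'D_i ('D_i v) x = 'D_1 ('D_1 f) 0.
    by rewrite -D1 -(derive_line ('D_i v)) scale0r add0r.
  have [_ dvx] := dv x i Ax ie.
  rewrite D2v; apply: second_derivative_test.
  - have : \forall t \near (0 : R), A (t *: i + x).
      by apply: near_line; exact: near_open Ax _.
    apply: filterS => t At.
    by have [/derivableP/is_derive_line[]] := dv _ i At ie.
  - rewrite -D1; have /derivableP/is_derive_at[] := dvx; done.
  - rewrite f0; apply: (@near_line (fun y => v y <= v x)).
    exact: (near_open oA Ax).
by rewrite /laplacian -[leRHS]addr0 lerD // D2 // !inE eqxx ?orbT.
Qed.

End MaximumPrinciple.

Section Uniqueness.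
Context {R : realType}.
Variables (r1 r2 : R).
Hypotheses (r1_gt0 : 0 < r1) (r12 : r1 < r2).
Implicit Types (v w : R * R -> R) (x : R * R).

Let r2_gt0 : 0 < r2 := lt_trans r1_gt0 r12.

(** Its Laplacian is [-4] and it increases with [r] up to the outer circle
    included, since its derivative in [s] is [2 r2^2 / s - 1]. *)
Definition barrier : R -> R := log_poly 0 (2 * r2 ^+ 2) (- 1) 0 0.
Definition barrier1 : R -> R := log_poly1 (2 * r2 ^+ 2) (- 1) 0 0.
Definition barrier2 : R -> R := log_poly2 (2 * r2 ^+ 2) 0 0.

Lemma profile_barrier : profile barrier barrier1 barrier2.
Proof. exact: profile_log_poly. Qed.

(** Both inner conditions are treated at once, since they only differ in the
    bound at a maximum on the inner circle. *)
Definition inner_homogeneous w :=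
  inner_dirichlet r1 0 w \/ exists2 alpha, 0 < alpha & inner_robin r1 alpha 0 w.

Lemma within_continuous_radial F F1 F2 : profile F F1 F2 ->
  {within closed_annulus r1 r2, continuous (F \o sqn)}.
Proof.
move=> HF; apply/continuous_in_subspaceT => x /set_mem xA.
exact: continuous_radial HF _ (closed_annulus_sqn_gt0 r1_gt0 xA).
Qed.

Lemma annulus_sqn_gt0 x : annulus r1 r2 x -> 0 < sqn x.
Proof. by move=> /annulus_sub_closed; exact: closed_annulus_sqn_gt0. Qed.

Lemma barrier_outer : 0 < barrier1 (r2 ^+ 2).
Proof.
have r2s : r2 ^+ 2 != 0 by rewrite gt_eqF ?exprn_gt0.
by rewrite /barrier1 /log_poly1 mulfK //; lra.
Qed.

(** The function [w - eps * barrier] has positive Laplacian, and negative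
    normal derivative on the outer circle, so it attains its maximum on the
    inner circle; there [w] is zero or, by the sign of the normal derivative,
    at most [O(eps / alpha)].  Hence [w <= O(eps)] everywhere. *)
Lemma mixed_le0 w :
    twice_derivable (annulus r1 r2) w ->
    {within closed_annulus r1 r2, continuous w} ->
    (forall x, annulus r1 r2 x -> laplacian w x = 0) ->
    outer_flux r2 0 w -> inner_homogeneous w ->
  forall x, closed_annulus r1 r2 x -> w x <= 0.
Proof.
move=> dw cw Lw ow iw x xA.
(* If the maximum is on the inner circle, the bound is linear in [e]. *)
have [M Mbound] : exists M, forall e, 0 < e ->
    forall y, circle r1 y ->
    (forall z, closed_annulus r1 r2 z ->
       w z - e * barrier (sqn z) <= w y - e * barrier (sqn y)) ->
    w x <= e * M.
  have bnd y e c : circle r1 y -> w y <= e * c ->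
      w x - e * barrier (sqn x) <= w y - e * barrier (sqn y) ->
      w x <= e * (c + barrier (sqn x) - barrier (r1 ^+ 2)).
    move=> /circle_sqn ->; move: (barrier _) (barrier _) => bx b1.
    by rewrite mulrBr mulrDr; lra.
  case: iw => [iw|[alpha a0 iw]].
    exists (0 + barrier (sqn x) - barrier (r1 ^+ 2)) => e e0 y yr1 ymax.
    by apply: (bnd y e 0 yr1 _ (ymax _ xA)); rewrite (iw y yr1) mulr0.
  exists (2 * r1 * barrier1 (r1 ^+ 2) / alpha + barrier (sqn x) - barrier (r1 ^+ 2)).
  move=> e e0 y yr1 ymax.
  apply: (bnd y e _ yr1 _ (ymax _ xA)).
  have y0 : 0 < sqn y by rewrite (circle_sqn yr1) exprn_gt0.
  have nb := normal_derivative_radial (k := - r1^-1) (profileZ e profile_barrier) y0.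
  rewrite scaleNr in nb.
  have ynear : \forall h \near (0 : R)^'-,
      (w \- ((e \*o barrier) \o sqn)) (y + h *: normal_inner_circle r1 y)
      <= (w \- ((e \*o barrier) \o sqn)) y.
    apply: filterS (inner_normal_inside r1_gt0 r12 yr1) => h.
    exact: ymax.
  have := normal_derivative_max (normal_derivativeB (iw y yr1) nb) ynear.
  rewrite (circle_sqn yr1) subr0 /=.
  have -> : e * barrier1 (r1 ^+ 2) * (2 * - r1^-1 * r1 ^+ 2) =
            - (e * (2 * r1 * barrier1 (r1 ^+ 2))) by field; rewrite gt_eqF.
  rewrite opprK => le; rewrite -(ler_pM2l a0).
  have -> : alpha * (e * (2 * r1 * barrier1 (r1 ^+ 2) / alpha)) =
    e * (2 * r1 * barrier1 (r1 ^+ 2)) by field; rewrite gt_eqF.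
  lra.
(* In the interior the sign of the Laplacian excludes a maximum, and on the
   outer circle the sign of the flux. *)
have step e : 0 < e -> w x <= e * M.
  move=> e0.
  pose b : R * R -> R := (e \*o barrier) \o sqn.
  have pb := profileZ e profile_barrier.
  have cwb : {within closed_annulus r1 r2, continuous (w \- b)}.
    by move=> z; apply: continuousB; [exact: cw|exact: within_continuous_radial pb z].
  have cA := @compact_closed_annulus R r1 r2.
  have [y yA ymax] := compact_EVT_max (ex_intro _ x xA) cA cwb.
  have {}ymax z : closed_annulus r1 r2 z -> (w \- b) z <= (w \- b) y.
    by move=> zA; apply: ymax; exact: mem_set.
  have [yr1|yO|yr2] := closed_annulus_cases (set_mem yA).
  - exact: Mbound e0 y yr1 ymax.
  - have db : twice_derivable (annulus r1 r2) b.
      exact: twice_derivable_radial pb _ annulus_sqn_gt0.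
    have oO := @open_annulus R r1 r2.
    have ymaxO z : annulus r1 r2 z -> (w \- b) z <= (w \- b) y.
      by move=> /annulus_sub_closed; exact: ymax.
    have := laplacian_at_max oO (twice_derivableB oO dw db) yO ymaxO.
    rewrite (laplacianB oO dw db yO) (Lw _ yO).
    have y0 := annulus_sqn_gt0 yO.
    have := log_poly_laplacian (2 * r2 ^+ 2) (- 1) 0 0 y0.
    rewrite (laplacian_radial pb y0) /= -/barrier1 -/barrier2 => Lb.
    have -> : 4 * (sqn y * (e * barrier2 (sqn y)) + e * barrier1 (sqn y)) =
        e * (4 * (sqn y * barrier2 (sqn y) + barrier1 (sqn y))) by ring.
    rewrite Lb.
    by lra.
  - have y0 : 0 < sqn y by rewrite (circle_sqn yr2) exprn_gt0.
    have nb := normal_derivative_radial (k := r2^-1) pb y0.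
    have ynear : \forall h \near (0 : R)^'-,
      (w \- ((e \*o barrier) \o sqn)) (y + h *: normal_outer_circle r2 y)
      <= (w \- ((e \*o barrier) \o sqn)) y.
      by apply: filterS (outer_normal_inside r1_gt0 r12 yr2) => h; exact: ymax.
    have := normal_derivative_max (normal_derivativeB (ow y yr2) nb) ynear.
    rewrite (circle_sqn yr2) /= leNgt.
    by rewrite oppr0 add0r oppr_lt0 !mulr_gt0 ?barrier_outer ?invr_gt0 ?exprn_gt0.
rewrite leNgt; apply/negP => wx.
have c0 : 0 < `|M| + 1 by rewrite ltr_wpDl.
have e0 : 0 < w x / (2 * (`|M| + 1)) by rewrite divr_gt0 // mulr_gt0.
have Mc : M <= `|M| + 1 by rewrite (le_trans (ler_norm M)) // lerDl.
have := le_trans (step _ e0) (ler_wpM2l (ltW e0) Mc).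
have -> : w x / (2 * (`|M| + 1)) * (`|M| + 1) = w x / 2.
  by field; rewrite gt_eqF.
lra.
Qed.

Lemma mixed_eq0 w :
    twice_derivable (annulus r1 r2) w ->
    {within closed_annulus r1 r2, continuous w} ->
    (forall x, annulus r1 r2 x -> laplacian w x = 0) ->
    outer_flux r2 0 w -> inner_homogeneous w ->
  forall x, closed_annulus r1 r2 x -> w x = 0.
Proof.
move=> dw cw Lw ow iw x xA; apply/eqP; rewrite eq_le (mixed_le0 dw) //=.
rewrite -oppr_le0.
pose z := (fun=> 0 : R) \o (@sqn R).
have pz := @profile_cst R 0.
have dz : twice_derivable (annulus r1 r2) z.
  exact: twice_derivable_radial pz _ annulus_sqn_gt0.
have oO := @open_annulus R r1 r2.
have nz y k : 0 < sqn y -> normal_derivative z y (k *: y) 0.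
  by move=> y0; have := normal_derivative_radial (k := k) pz y0; rewrite mul0r.
rewrite -sub0r; apply: (@mixed_le0 (z \- w)) xA.
- exact: twice_derivableB.
- by move=> y; apply: continuousB; [exact: within_continuous_radial pz y|exact: cw].
- move=> y yO; rewrite (laplacianB oO dz dw yO) Lw // (laplacian_radial pz).
    by rewrite mulr0 addr0 mulr0 subr0.
  exact: annulus_sqn_gt0.
- move=> y yr2; rewrite (_ : - 0 = 0 - - 0 :> R); last by rewrite !oppr0 addr0.
  apply: normal_derivativeB; last exact: ow.
  by apply: nz; rewrite (circle_sqn yr2) exprn_gt0.
- case: iw => [iw|[alpha a0 iw]]; [left|right].
    by move=> y yr1; rewrite /= iw // subr0.
  exists alpha => // y yr1.
  rewrite (_ : - _ = 0 - - (alpha * (w y - 0))); last first.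
    by rewrite /= !subr0 !sub0r mulrN.
  apply: normal_derivativeB; last exact: iw.
  rewrite /normal_inner_circle -scaleNr.
  by apply: nz; rewrite (circle_sqn yr1) exprn_gt0.
Qed.

End Uniqueness.

(** * Area of the annulus *)

Section DiskArea.
Context {R : realType}.
Implicit Types (a x : R).

(** Obtained by inverting [a * sin] on a closed interval, which gives
    continuity at the two end points, where [asin] is not differentiable. *)
Lemma within_continuous_asin_div a : 0 < a ->
  {within `[- a, a], continuous (fun x => asin (x / a))}.
Proof.
move=> a0; have an0 : a != 0 by rewrite gt_eqF.
have pi2 : - (pi / 2) <= pi / 2 :> R.
  by rewrite -subr_ge0 opprK -splitr pi_ge0.
have cf : {within `[- (pi / 2), pi / 2], continuous (fun y : R => a * sin y)}.
  apply: continuous_subspaceT => y.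
  by apply: cvgM; [exact: cvg_cst|exact: continuous_sin].
have fK : {in `[- (pi / 2), pi / 2],
    cancel (fun y : R => a * sin y) (fun x => asin (x / a))}.
  by move=> y yI; rewrite mulrAC divff // mul1r sinK.
have := segment_can_le_continuous pi2 cf fK.
by rewrite sinN sin_pihalf mulrN mulr1.
Qed.

Lemma half_chord_continuous a : continuous (fun x => Num.sqrt (a ^+ 2 - x ^+ 2)).
Proof.
move=> x; apply: (@continuous_comp _ _ _ (fun x => a ^+ 2 - x ^+ 2) Num.sqrt).
  by apply: cvgB; [exact: cvg_cst|exact: exprn_continuous].
exact: sqrt_continuous.
Qed.

Definition disk_primitive a x :=
  x * Num.sqrt (a ^+ 2 - x ^+ 2) + a ^+ 2 * asin (x / a).

Lemma is_derive_disk_primitive a x : 0 < a -> - a < x < a ->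
  is_derive x 1 (disk_primitive a) (2 * Num.sqrt (a ^+ 2 - x ^+ 2)).
Proof.
move=> a0 xa; have an0 : a != 0 by rewrite gt_eqF.
have d0 : 0 < a ^+ 2 - x ^+ 2.
  by rewrite subr_sqr; case/andP: xa => ? ?; rewrite mulr_gt0 //; lra.
have s0 : 0 < Num.sqrt (a ^+ 2 - x ^+ 2) by rewrite sqrtr_gt0.
have s2 : Num.sqrt (a ^+ 2 - x ^+ 2) ^+ 2 = a ^+ 2 - x ^+ 2.
  by rewrite sqr_sqrtr // ltW.
have d1 : is_derive x 1 (fun x => a ^+ 2 - x ^+ 2) (- (2 * x)).
  by apply: is_derive_eq; rewrite /GRing.scale /=; ring.
have d2 := @is_derive1_comp _ Num.sqrt (fun x => a ^+ 2 - x ^+ 2) x _ _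
  (is_derive1_sqrt d0) d1.
have d3 : is_derive x 1 (fun x => x / a) a^-1.
  by apply: is_derive_eq; rewrite /GRing.scale /=; ring.
have xa1 : -1 < x / a < 1.
  by rewrite ltr_pdivlMr // ltr_pdivrMr // mulN1r mul1r.
have d4 := @is_derive1_comp _ asin (fun x => x / a) x _ _
  (is_derive1_asin xa1) d3.
have -> : disk_primitive a =
    (id * (Num.sqrt \o (fun x => a ^+ 2 - x ^+ 2)))
    + (a ^+ 2 \*o (asin \o (fun x => x / a))) by [].
have d5 := is_deriveM (is_derive_id x 1) d2.
have d6 := is_deriveZ (a ^+ 2) d4.
apply: (is_derive_eq (is_deriveD d5 d6)).
have -> : Num.sqrt (1 - (x / a) ^+ 2) = Num.sqrt (a ^+ 2 - x ^+ 2) / a.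
  rewrite (_ : 1 - (x / a) ^+ 2 = (a ^+ 2 - x ^+ 2) * a^-1 ^+ 2).
    by rewrite sqrtrM ?ltW // sqrtr_sqr gtr0_norm // invr_gt0.
  by field.
rewrite /GRing.scale /=; move: (Num.sqrt _) s0 s2 => s s0 s2.
have sn0 : s != 0 by rewrite gt_eqF.
have -> : x * ((2 * s)^-1 * - (2 * x)) + s * 1 + a ^+ 2 * ((s / a)^-1 * a^-1)
  = s + (a ^+ 2 - x ^+ 2) / s by field; rewrite sn0 an0.
by rewrite -s2; field.
Qed.

Lemma integral_chords a : 0 < a ->
  (\int[lebesgue_measure]_(x in `[(- a)%R, a])
     (2 * Num.sqrt (a ^+ 2 - x ^+ 2))%R%:E = (pi * a ^+ 2)%R%:E)%E.
Proof.
move=> a0; have an0 : a != 0 by rewrite gt_eqF.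
have Naa : - a < a by lra.
have cchord : {within `[- a, a], continuous (fun x => 2 * Num.sqrt (a ^+ 2 - x ^+ 2))}.
  apply: continuous_subspaceT => x.
  by apply: cvgM; [exact: cvg_cst|exact: half_chord_continuous].
have cprim : {within `[- a, a], continuous (disk_primitive a)}.
  pose f1 x := x * Num.sqrt (a ^+ 2 - x ^+ 2).
  have c1 : {within `[- a, a], continuous f1}.
    apply: continuous_subspaceT => y.
    by apply: cvgM; [exact: cvg_id|exact: half_chord_continuous].
  pose f2 x := asin (x / a).
  have c2 : {within `[- a, a], continuous (cst (a ^+ 2) * f2)}.
    move=> y; apply: continuousM; first exact: cvg_cst.
    exact: within_continuous_asin_div.
  have -> : disk_primitive a = f1 + cst (a ^+ 2) * f2 by [].
  by move=> x; apply: continuousD; [exact: c1|exact: c2].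
have dprim x : x \in `]- a, a[ ->
    is_derive x 1 (disk_primitive a) (2 * Num.sqrt (a ^+ 2 - x ^+ 2)).
  by rewrite in_itv /=; exact: is_derive_disk_primitive.
have /(continuous_within_itvP _ Naa)[_ cl cr] := cprim.
rewrite (continuous_FTC2 Naa cchord (F := disk_primitive a)).
- rewrite -EFinB /disk_primitive; congr EFin.
  rewrite sqrrN subrr sqrtr0 !mulr0 !add0r mulNr divff //.
  have pi2 : - (pi / 2) <= pi / 2 :> R.
    by rewrite -subr_ge0 opprK -splitr pi_ge0.
  have -> : asin 1 = pi / 2 :> R.
    have := @sinK R (pi / 2); rewrite sin_pihalf; apply.
    by rewrite in_itv /= pi2 lexx.
  have -> : asin (-1) = - (pi / 2) :> R.
    have := @sinK R (- (pi / 2)); rewrite sinN sin_pihalf; apply.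
    by rewrite in_itv /= pi2 lexx.
  by field.
- by split => // x xI; have [] := dprim x xI.
- by move=> x xI; rewrite derive1E; have [_ ->] := dprim x xI.
Qed.

End DiskArea.

Section AnnulusArea.
Context {R : realType}.
Implicit Types (a b x c : R).

Notation plane := (measurableTypeR R * measurableTypeR R)%type.

Lemma measurable_sqn (A : set plane) :
  measurable_fun A (@sqn R : plane -> measurableTypeR R).
Proof.
apply: (measurable_funS measurableT (@subsetT _ A)).
by apply: measurable_funD; apply: measurable_funX.
Qed.

(** Cavalieri's principle: outside [- a, a] the square root is [0], which
    agrees with the slices being negligible. *)
Lemma lebesgue2_chords a (D : set (R * R)) : 0 < a ->
  (forall x, lebesgue_measure (xsection D x) =
     (2 * Num.sqrt (a ^+ 2 - x ^+ 2))%:E) ->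
  lebesgue2 D = (pi * a ^+ 2)%:E.
Proof.
move=> a0 slice; rewrite -integral_chords // integral_mkcond.
apply: eq_integral => x _.
rewrite patchE; case: ifPn => [_|]; first exact: slice.
rewrite notin_setE /= in_itv /= -ler_norml => /negP; rewrite -ltNge => ax.
rewrite [LHS]slice ler0_sqrtr ?mulr0 // subr_le0 -[leRHS]real_normK ?num_real //.
by rewrite ler_pXn2r ?nnegrE // ltW.
Qed.

Lemma sqr_lt_sqrt c x : (x ^+ 2 < c) = (`|x| < Num.sqrt c).
Proof.
have [c0|c0] := ltP 0 c; first by rewrite -sqrtr_sqr ltr_sqrt.
rewrite ler0_sqrtr // normr_lt0; apply/negbTE.
by rewrite -leNgt (le_trans c0) ?sqr_ge0.
Qed.

Lemma sqr_le_sqrt c x : 0 <= c -> (x ^+ 2 <= c) = (`|x| <= Num.sqrt c).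
Proof. by move=> c0; rewrite -sqrtr_sqr ler_sqrt. Qed.

Lemma lebesgue_measure_sym_itv (l r : bool) x : 0 <= x ->
  lebesgue_measure [set` Interval (BSide l (- x)) (BSide r x)] = (2 * x)%:E.
Proof.
move=> x0; rewrite lebesgue_measure_itv /= lte_fin.
by case: ltP => xx; [rewrite -EFinB|]; congr EFin; lra.
Qed.

Lemma lebesgue2_open_disk a : 0 < a ->
  lebesgue2 [set x | sqn x < a ^+ 2] = (pi * a ^+ 2)%:E.
Proof.
move=> a0; apply: lebesgue2_chords => // x.
rewrite (_ : xsection _ x =
    `]- Num.sqrt (a ^+ 2 - x ^+ 2), Num.sqrt (a ^+ 2 - x ^+ 2)[%classic).
  by rewrite lebesgue_measure_sym_itv ?sqrtr_ge0.
apply/seteqP; split=> y;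
  rewrite /xsection /= inE /sqn /= in_itv /= -ltr_norml -sqr_lt_sqrt;
  by rewrite ltrBrDl.
Qed.

Lemma lebesgue2_closed_disk a : 0 < a ->
  lebesgue2 [set x | sqn x <= a ^+ 2] = (pi * a ^+ 2)%:E.
Proof.
move=> a0; apply: lebesgue2_chords => // x.
have [c0|c0] := leP 0 (a ^+ 2 - x ^+ 2); last first.
  rewrite ler0_sqrtr ?(ltW c0) // mulr0 (_ : xsection _ x = set0) ?measure0 //.
  apply/seteqP; split=> // y; rewrite /xsection /= inE /sqn /= => xy.
  by have y0 := sqr_ge0 y; exfalso; lra.
rewrite (_ : xsection _ x =
    `[- Num.sqrt (a ^+ 2 - x ^+ 2), Num.sqrt (a ^+ 2 - x ^+ 2)]%classic).
  by rewrite lebesgue_measure_sym_itv ?sqrtr_ge0.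
apply/seteqP; split=> y;
  rewrite /xsection /= inE /sqn /= in_itv /= -ler_norml -sqr_le_sqrt //;
  by rewrite lerBrDl.
Qed.

Lemma measurable_sqn_set (I : interval R) :
  measurable [set x : R * R | sqn x \in I].
Proof.
rewrite (_ : [set x | _] = setT `&` @sqn R @^-1` [set` I]).
  exact: measurable_sqn.
by rewrite setTI.
Qed.

(** The open disk of radius [b] minus the closed disk of radius [a]. *)
Lemma lebesgue2_annulus a b : 0 < a -> a < b ->
  lebesgue2 [set x | a ^+ 2 < sqn x < b ^+ 2] = (pi * (b ^+ 2 - a ^+ 2))%:E.
Proof.
move=> a0 ab; have b0 := lt_trans a0 ab.
have ab2 : a ^+ 2 < b ^+ 2 by rewrite ltr_pXn2r ?nnegrE ?ltW.
have mo := measurable_sqn_set `]-oo, b ^+ 2[.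
have mc := measurable_sqn_set `]-oo, a ^+ 2].
rewrite (_ : [set x | _] = [set x | sqn x < b ^+ 2] `\` [set x | sqn x <= a ^+ 2]).
  have sub : [set x : R * R | sqn x <= a ^+ 2] `<=` [set x | sqn x < b ^+ 2].
    by move=> x /= /le_lt_trans; apply.
  rewrite /lebesgue2 measureD.
  - rewrite (_ : _ `&` _ = [set x | sqn x <= a ^+ 2]); last first.
      by apply/setIidPr.
    rewrite [X in (X - _)%E]lebesgue2_open_disk //.
    rewrite [X in (_ - X)%E]lebesgue2_closed_disk //.
    by rewrite -EFinB -mulrBr.
  - exact: mo.
  - exact: mc.
  - by rewrite [X in (X < _)%E]lebesgue2_open_disk // ltry.
apply/seteqP; split=> x /=.
  by case/andP=> h ->; split => //; apply/negP; rewrite -ltNge.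
by move=> [-> /negP]; rewrite -ltNge => ->.
Qed.

End AnnulusArea.

(** * Integrals of radial functions *)

Section RadialIntegrals.
Context {R : realType}.
Variables (r1 r2 : R).
Hypotheses (r1_gt0 : 0 < r1) (r12 : r1 < r2).
Implicit Types (F G : R -> R) (v : R * R -> R).

Notation plane := (measurableTypeR R * measurableTypeR R)%type.
Notation Omega := (annulus r1 r2).

Lemma annulusE : Omega = [set x | r1 ^+ 2 < sqn x < r2 ^+ 2].
Proof.
apply/seteqP; split=> x; first exact: annulus_sqn.
exact: sqn_annulus.
Qed.

Lemma lebesgue2_Omega : lebesgue2 Omega = (pi * (r2 ^+ 2 - r1 ^+ 2))%:E.
Proof. by rewrite annulusE lebesgue2_annulus. Qed.

Lemma measurable_annulus : measurable (Omega : set plane).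
Proof.
rewrite annulusE (_ : [set x | _] = [set x | sqn x \in `]r1 ^+ 2, r2 ^+ 2[]).
  exact: measurable_sqn_set.
by apply/seteqP; split => x; rewrite /= in_itv.
Qed.

Definition continuous_pos F := forall s, 0 < s -> {for s, continuous F}.

(** [F] is continuous on the compact interval from [r1^2] to [r2^2], hence
    bounded there. *)
Lemma integrable_radial F : continuous_pos F ->
  (lebesgue2 : {measure set plane -> \bar R}).-integrable Omega
    (EFin \o (F \o sqn)).
Proof.
move=> cF; apply: measurable_bounded_integrable.
- exact: measurable_annulus.
- by rewrite [X in (X < _)%E]lebesgue2_Omega ltry.
- apply: (@measurable_comp _ _ _ plane (measurableTypeR R) (measurableTypeR R)
    `]0, +oo[%classic F Omega sqn).
  + exact: measurable_itv.
  + move=> _ [x xO <-] /=; rewrite in_itv /= andbT.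
    exact: annulus_sqn_gt0 xO.
  + apply: open_continuous_measurable_fun; first exact: interval_open.
    by move=> s; rewrite inE /= in_itv /= andbT; exact: cF.
  + exact: measurable_sqn.
- have cF' : {within `[r1 ^+ 2, r2 ^+ 2], continuous F}.
    apply: continuous_in_subspaceT => s; rewrite inE /= in_itv /= => /andP[s1 _].
    by apply: cF; rewrite (lt_le_trans _ s1) ?exprn_gt0.
  have := compact_bounded (continuous_compact cF' (@segment_compact _ _ _)).
  move=> [M [Mreal MF]]; exists M; split => // m /MF mF x /= xO.
  apply: mF; exists (sqn x) => //=.
  by rewrite in_itv /=; have /andP[/ltW -> /ltW ->] := annulus_sqn r1_gt0 xO.
Qed.

Definition radial_integral F : R :=
  (\int[lebesgue2]_(x in Omega) F (sqn x))%R.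

Lemma radial_integralE F : continuous_pos F ->
  (\int[lebesgue2]_(x in Omega) (F (sqn x))%:E)%E = (radial_integral F)%:E.
Proof.
move=> cF; rewrite fineK //.
exact: (integrable_fin_num measurable_annulus (integrable_radial cF)).
Qed.

(** Only the square of [v] has to be radial, so this also covers the Euclidean
    norm of the gradient of a radial function. *)
Lemma L2norm_radial v F : continuous_pos F ->
  (forall x, Omega x -> v x ^+ 2 = F (sqn x)) ->
  L2norm Omega v = (Num.sqrt (radial_integral F))%:E.
Proof.
move=> cF vF; rewrite /L2norm unlock.
rewrite (_ : (\int[_]_x _)%E = (radial_integral F)%:E).
  rewrite poweR_EFin powR12_sqrt //.
  apply: Rintegral_ge0 => x xO; rewrite -vF //.
  exact: sqr_ge0.
rewrite -radial_integralE // [RHS]integral_mkcond.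
apply: eq_integral => x _; rewrite !patchE; case: ifPn => [/set_mem xO|_].
  by rewrite /= -vF // powR_mulrn ?normr_ge0 // real_normK // num_real.
by rewrite /= normr0 powR0 // pnatr_eq0.
Qed.

Lemma continuous_posD F G : continuous_pos F -> continuous_pos G ->
  continuous_pos (fun s => F s + G s).
Proof. by move=> cF cG s s0; apply: cvgD; [exact: cF|exact: cG]. Qed.

Lemma continuous_posM F G : continuous_pos F -> continuous_pos G ->
  continuous_pos (fun s => F s * G s).
Proof. by move=> cF cG s s0; apply: cvgM; [exact: cF|exact: cG]. Qed.

Lemma continuous_pos_cst c : continuous_pos (fun=> c).
Proof. by move=> s s0; apply: cvg_cst. Qed.

Lemma radial_integralD F G : continuous_pos F -> continuous_pos G ->
  radial_integral (fun s => F s + G s) = radial_integral F + radial_integral G.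
Proof.
move=> cF cG; apply: (RintegralD measurable_annulus);
  exact: integrable_radial.
Qed.

Lemma radial_integralZ c F : continuous_pos F ->
  radial_integral (fun s => c * F s) = c * radial_integral F.
Proof.
move=> cF; apply: (RintegralZl c measurable_annulus (integrable_radial cF)).
Qed.

Lemma radial_integral_cst c :
  radial_integral (fun=> c) = c * (pi * (r2 ^+ 2 - r1 ^+ 2)).
Proof.
rewrite /radial_integral Rintegral_cst; last exact: measurable_annulus.
by rewrite [X in fine X]lebesgue2_Omega.
Qed.

Lemma radial_integral_ge0 F : (forall s, 0 < s -> 0 <= F s) ->
  0 <= radial_integral F.
Proof.
move=> F0; apply: Rintegral_ge0 => x xO; apply: F0.
exact: annulus_sqn_gt0 xO.
Qed.

End RadialIntegrals.

Section RadialIntegralZero.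
Context {R : realType}.
Implicit Types (F : R -> R).

Lemma le_radial_integral_sub (r1 r2 a b : R) F : 0 < r1 -> r1 < r2 ->
    0 < a -> a < b -> annulus a b `<=` annulus r1 r2 ->
    continuous_pos F -> (forall s, 0 < s -> 0 <= F s) ->
  radial_integral a b F <= radial_integral r1 r2 F.
Proof.
move=> r10 r12 a0 ab sub cF F0.
rewrite -lee_fin -!radial_integralE //.
apply: ge0_subset_integral => //.
- exact: measurable_annulus.
- exact: measurable_annulus.
- exact: (measurable_int _ (integrable_radial r10 r12 cF)).
- by move=> x xO; rewrite lee_fin; apply: F0; exact: annulus_sqn_gt0 r10 _ xO.
Qed.

Lemma radial_integral_ge_cst (a b m : R) F : 0 < a -> a < b ->
    continuous_pos F -> (forall x, annulus a b x -> m <= F (sqn x)) ->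
  m * (pi * (b ^+ 2 - a ^+ 2)) <= radial_integral a b F.
Proof.
move=> a0 ab cF mF; rewrite -radial_integral_cst //.
exact: (le_Rintegral (measurable_annulus a0 ab)
  (integrable_radial a0 ab (continuous_pos_cst (c := m)))
  (integrable_radial a0 ab cF)).
Qed.

(** If [F] is positive at a point, it is bounded below on a thin annulus
    through this point, whose area is positive. *)
Lemma radial_integral_eq0 (r1 r2 : R) F : 0 < r1 -> r1 < r2 ->
    continuous_pos F -> (forall s, 0 < s -> 0 <= F s) ->
    radial_integral r1 r2 F = 0 ->
  forall x, annulus r1 r2 x -> F (sqn x) = 0.
Proof.
move=> r10 r12 cF F0 I0 x xO; apply/eqP; apply/negPn/negP => Fx.
have s0 := annulus_sqn_gt0 r10 xO.
have {Fx} Fx : 0 < F (sqn x) by rewrite lt_neqAle eq_sym Fx F0.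
have /andP[s1 s2] := annulus_sqn r10 xO.
move: (sqn x) s0 Fx s1 s2 => s s0 Fx s1 s2.
have : \forall t \near s, F s / 2 < F t.
  by apply: (cvgr_gt _ (cF s s0)); lra.
move=> /nbhs_ballP[d /= d0 Bd].
(* Half the distances, so that the thin annulus stays strictly inside. *)
pose e := Num.min (d / 2) (Num.min ((s - r1 ^+ 2) / 2) ((r2 ^+ 2 - s) / 2)).
have [ed es1 es2] : [/\ e <= d / 2, e <= (s - r1 ^+ 2) / 2 & e <= (r2 ^+ 2 - s) / 2].
  by rewrite /e !ge_min !lexx !orbT; split.
have e0 : 0 < e by rewrite /e !lt_min; apply/and3P; split; lra.
have r1s : 0 < r1 ^+ 2 by rewrite exprn_gt0.
clearbody e.
pose a := Num.sqrt (s - e); pose b := Num.sqrt (s + e).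
have a2 : a ^+ 2 = s - e by rewrite sqr_sqrtr //; lra.
have b2 : b ^+ 2 = s + e by rewrite sqr_sqrtr //; lra.
have a0 : 0 < a by rewrite sqrtr_gt0; lra.
have ab : a < b by rewrite ltr_sqrt //; lra.
have sub : annulus a b `<=` annulus r1 r2.
  move=> y; rewrite !annulusE // /= a2 b2 => /andP[? ?].
  by apply/andP; split; lra.
have := le_radial_integral_sub r10 r12 a0 ab sub cF F0.
rewrite I0; apply/negP; rewrite -ltNge.
apply: lt_le_trans (_ : F s / 2 * (pi * (b ^+ 2 - a ^+ 2)) <= _).
  by rewrite !mulr_gt0 ?invr_gt0 ?pi_gt0 // a2 b2; lra.
apply: radial_integral_ge_cst => // y /(annulus_sqn a0).
rewrite a2 b2 => /andP[? ?]; apply/ltW/Bd.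
by rewrite /ball /= ltr_norml; apply/andP; split; lra.
Qed.

End RadialIntegralZero.

(** * Explicit solutions of the mixed problems *)

Section MixedProblem.
Context {R : realType}.
Variables (r1 r2 : R).
Hypotheses (r1_gt0 : 0 < r1) (r12 : r1 < r2).
Implicit Types (F : R -> R) (v : R * R -> R).

(** Pairs each inner condition with what it means for [F \o sqn], whose
    derivative in [r] at [r1] is [2 r1 F1 (r1^2)]. *)
Definition inner_match c v (F F1 : R -> R) :=
  (inner_dirichlet r1 c v /\ F (r1 ^+ 2) = c) \/
  exists2 alpha, 0 < alpha &
    inner_robin r1 alpha c v /\
    2 * r1 * F1 (r1 ^+ 2) = alpha * (F (r1 ^+ 2) - c).

(** The difference with [F \o sqn] solves the homogeneous mixed problem. *)
Lemma mixed_radial c q f v F F1 F2 :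
    profile F F1 F2 -> poisson r1 r2 f v -> outer_flux r2 q v ->
    (forall x, annulus r1 r2 x ->
       - (4 * (sqn x * F2 (sqn x) + F1 (sqn x))) = f x) ->
    - (2 * r2 * F1 (r2 ^+ 2)) = q ->
    inner_match c v F F1 ->
  forall x, closed_annulus r1 r2 x -> v x = F (sqn x).
Proof.
move=> HF [Cv cv Lv] ov Lf oF iv x xA.
have r2_gt0 := lt_trans r1_gt0 r12.
have dv := C2_on_twice_derivable Cv.
have dF := twice_derivable_radial HF (fun x => @annulus_sqn_gt0 _ r1 r2 r1_gt0 x).
have oO := @open_annulus R r1 r2.
apply/eqP; rewrite -subr_eq0; apply/eqP.
apply: (@mixed_eq0 R r1 r2 r1_gt0 r12 (v \- (F \o sqn))) xA.
- exact: (twice_derivableB oO dv dF).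
- move=> y; apply: continuousB; first exact: cv.
  exact: (within_continuous_radial r1_gt0 HF).
- move=> y yO; rewrite (laplacianB oO dv dF yO).
  rewrite (laplacian_radial HF (annulus_sqn_gt0 r1_gt0 yO)) -[laplacian v y]opprK.
  by rewrite Lv // -Lf // opprK subrr.
- move=> y yr2; have y0 : 0 < sqn y by rewrite (circle_sqn yr2) exprn_gt0.
  have := normal_derivativeB (ov y yr2) (normal_derivative_radial (k := r2^-1) HF y0).
  rewrite (circle_sqn yr2) -oF opprK oppr0.
  suff -> : 2 * r2 * F1 (r2 ^+ 2) - F1 (r2 ^+ 2) * (2 * r2^-1 * r2 ^+ 2) = 0 by [].
  by field; rewrite gt_eqF.
- case: iv => [[iv iF]|[alpha a0 [iv iF]]]; [left|right].
    by move=> y yr1; rewrite /= (circle_sqn yr1) iF iv // subrr.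
  exists alpha => // y yr1.
  have y0 : 0 < sqn y by rewrite (circle_sqn yr1) exprn_gt0.
  have nF := normal_derivative_radial (k := - r1^-1) HF y0.
  rewrite scaleNr in nF.
  have := normal_derivativeB (iv y yr1) nF.
  rewrite /= (circle_sqn yr1).
  suff -> : - (alpha * (v y - c)) - F1 (r1 ^+ 2) * (2 * - r1^-1 * r1 ^+ 2) =
     - (alpha * (v y - F (r1 ^+ 2) - 0)) by [].
  have -> : F1 (r1 ^+ 2) * (2 * - r1^-1 * r1 ^+ 2) = - (2 * r1 * F1 (r1 ^+ 2)).
    by field; rewrite gt_eqF.
  by rewrite iF; ring.
Qed.

End MixedProblem.

Section ExplicitSolutions.
Context {R : realType}.
Variables (r1 r2 : R).
Hypotheses (r1_gt0 : 0 < r1) (r12 : r1 < r2).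

Let r2_gt0 : 0 < r2 := lt_trans r1_gt0 r12.

(** The coefficient of [ln s] is fixed by the outer flux and the constant one by
    the value [b] on the inner circle. *)
Definition state_coef0 (g q b : R) : R :=
  b - (g * r2 ^+ 2 / 4 - q * r2 / 2) * ln (r1 ^+ 2) + g * r1 ^+ 2 / 4.

Definition state_profile g q b : R -> R :=
  log_poly (state_coef0 g q b) (g * r2 ^+ 2 / 4 - q * r2 / 2) (- g / 4) 0 0.
Definition state_profile1 g q : R -> R :=
  log_poly1 (g * r2 ^+ 2 / 4 - q * r2 / 2) (- g / 4) 0 0.
Definition state_profile2 g q : R -> R :=
  log_poly2 (g * r2 ^+ 2 / 4 - q * r2 / 2) 0 0.

Lemma state_profileP g q b :
  [/\ profile (state_profile g q b) (state_profile1 g q) (state_profile2 g q),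
      forall s, 0 < s ->
        - (4 * (s * state_profile2 g q s + state_profile1 g q s)) = g,
      state_profile g q b (r1 ^+ 2) = b,
      - (2 * r2 * state_profile1 g q (r2 ^+ 2)) = q &
      2 * r1 * state_profile1 g q (r1 ^+ 2) =
        - ((2 * q * r2 - g * (r2 ^+ 2 - r1 ^+ 2)) / (2 * r1))].
Proof.
have r1n := gt_eqF r1_gt0; have r2n := gt_eqF r2_gt0.
split.
- exact: profile_log_poly.
- by move=> s s0; rewrite log_poly_laplacian //; field.
- by rewrite /state_profile /log_poly /state_coef0; field.
- by rewrite /state_profile1 /log_poly1; field; rewrite r2n.
- by rewrite /state_profile1 /log_poly1; field; rewrite r1n.
Qed.

(** The source has components on [1], [s] and [ln s], which determine the
    coefficients of [s], [s^2] and [s ln s]; the other two are free and fit the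
    boundary data. *)
Lemma adjoint_profile_exists g q b zd : exists P P1 P2 : R -> R,
  [/\ profile P P1 P2,
      forall s, 0 < s -> - (4 * (s * P2 s + P1 s)) = state_profile g q b s - zd,
      P (r1 ^+ 2) = 0 & P1 (r2 ^+ 2) = 0].
Proof.
pose c1 := g * r2 ^+ 2 / 4 - q * r2 / 2.
pose a4 := - c1 / 4.
pose a3 := g / 64.
pose a2 := (zd - state_coef0 g q b) / 4 + c1 / 2.
pose a1 := - (r2 ^+ 2 * (a2 + 2 * a3 * r2 ^+ 2 + a4 * (ln (r2 ^+ 2) + 1))).
pose a0 := - (a1 * ln (r1 ^+ 2) + a2 * r1 ^+ 2 + a3 * (r1 ^+ 2) ^+ 2
              + a4 * (r1 ^+ 2 * ln (r1 ^+ 2))).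
exists (log_poly a0 a1 a2 a3 a4), (log_poly1 a1 a2 a3 a4), (log_poly2 a1 a3 a4).
split.
- exact: profile_log_poly.
- move=> s s0; rewrite log_poly_laplacian // /state_profile /log_poly.
  by rewrite -/c1 /a2 /a3 /a4; field.
- by rewrite /log_poly /a0; ring.
- by rewrite /log_poly1 /a1; field; rewrite gt_eqF.
Qed.

(** The torsion function: a unit source, zero on the inner circle and flat on
    the outer one. *)
Lemma torsion_profile_exists : exists T T1 T2 : R -> R,
  [/\ profile T T1 T2,
      forall s, 0 < s -> - (4 * (s * T2 s + T1 s)) = 1,
      T (r1 ^+ 2) = 0 & T1 (r2 ^+ 2) = 0].
Proof.
exists (log_poly (r1 ^+ 2 / 4 - r2 ^+ 2 / 4 * ln (r1 ^+ 2)) (r2 ^+ 2 / 4) (- 1 / 4) 0 0).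
exists (log_poly1 (r2 ^+ 2 / 4) (- 1 / 4) 0 0), (log_poly2 (r2 ^+ 2 / 4) 0 0).
split.
- exact: profile_log_poly.
- by move=> s s0; rewrite log_poly_laplacian //; field.
- by rewrite /log_poly; ring.
- by rewrite /log_poly1; field; rewrite gt_eqF.
Qed.

(** The Laplacian of [A T + c] is [- A], and the annulus is nonempty. *)
Lemma torsion_independent T T1 T2 (A c : R) : profile T T1 T2 ->
    (forall s, 0 < s -> - (4 * (s * T2 s + T1 s)) = 1) ->
    (forall x, annulus r1 r2 x -> A * T (sqn x) + c = 0) ->
  A = 0 /\ c = 0.
Proof.
move=> HT eT AT.
have oO := @open_annulus R r1 r2.
have mid : r1 < (r1 + r2) / 2 < r2 by apply/andP; split; move: r12; lra.
have mid0 : 0 < (r1 + r2) / 2 by rewrite divr_gt0 ?addr_gt0.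
pose x : R * R := ((r1 + r2) / 2, 0).
have xO : annulus r1 r2 x.
  by rewrite /annulus /= /enorm /= expr0n /= addr0 sqrtr_sqr gtr0_norm ?mid.
have x0 := annulus_sqn_gt0 r1_gt0 xO.
have HG := profileD (profileZ A HT) (@profile_cst R c).
have L0 : laplacian ((fun=> 0 : R) \o (@sqn R)) x = 0.
  by rewrite (laplacian_radial (@profile_cst R 0) x0) mulr0 addr0 mulr0.
have := laplacian_radial HG x0.
rewrite (eq_laplacian (w := (fun=> 0 : R) \o (@sqn R)) oO xO) => [|y yO]; last first.
  exact: AT.
rewrite L0 /= !addr0 => E.
have A0 : A = 0.
  have := eT _ x0 => /(congr1 ( *%R A)); rewrite mulr1 => <-.
  by rewrite -[RHS]oppr0 E; ring.
by split => //; have := AT x xO; rewrite A0 mul0r add0r.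
Qed.

End ExplicitSolutions.

(** * Norms of radial functions and of the differences *)

Section RadialNorms.
Context {R : realType}.
Variables (r1 r2 : R).
Hypotheses (r1_gt0 : 0 < r1) (r12 : r1 < r2).
Implicit Types (v : R * R -> R).

Lemma continuous_pos_profile (F F1 F2 : R -> R) : profile F F1 F2 ->
  continuous_pos F /\ continuous_pos F1.
Proof.
move=> HF; split => s s0; have [[d _] [d1 _]] := HF s s0.
  exact/differentiable_continuous/derivable1_diffP.
exact/differentiable_continuous/derivable1_diffP.
Qed.

Lemma enorm_grad_radial v (F F1 F2 : R -> R) x : profile F F1 F2 ->
    (forall y, annulus r1 r2 y -> v y = F (sqn y)) -> annulus r1 r2 x ->
  enorm (grad v x) ^+ 2 = 4 * (sqn x * F1 (sqn x) ^+ 2).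
Proof.
move=> HF vF xO; have x0 := annulus_sqn_gt0 r1_gt0 xO.
have Dv i : 'D_i v x = F1 (sqn x) * (2 * dot x i).
  have [_ <-] := is_derive_radial HF i x0.
  apply: near_eq_derive.
  by apply: (near_open (@open_annulus R r1 r2) xO) => y; exact: vF.
by rewrite sqr_enorm /grad /sqn /= !Dv /dot /sqn /=; ring.
Qed.

(** The squared norm of the gradient of [F \o sqn]. *)
Definition grad_density (F1 : R -> R) (s : R) : R := 4 * (s * F1 s ^+ 2).

Lemma continuous_pos_grad_density F1 : continuous_pos F1 ->
  continuous_pos (grad_density F1).
Proof.
move=> cF; apply: continuous_posM; first exact: continuous_pos_cst.
apply: continuous_posM; first by move=> s _; exact: cvg_id.
exact: (continuous_posM cF cF).
Qed.

Lemma H1norm_radial v (F F1 F2 : R -> R) : profile F F1 F2 ->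
    (forall y, annulus r1 r2 y -> v y = F (sqn y)) ->
  H1norm (annulus r1 r2) v =
  (Num.sqrt (radial_integral r1 r2 (fun s => F s ^+ 2) +
             radial_integral r1 r2 (grad_density F1)))%:E.
Proof.
move=> HF vF; have [cF cF1] := continuous_pos_profile HF.
rewrite /H1norm.
rewrite (L2norm_radial (F := fun s => F s ^+ 2) r1_gt0 r12); last 2 first.
- exact: (continuous_posM cF cF).
- by move=> x xO; rewrite vF.
rewrite (L2norm_radial (F := grad_density F1) r1_gt0 r12); last 2 first.
- exact: continuous_pos_grad_density.
- by move=> x xO; rewrite /= (enorm_grad_radial HF vF).
have I1 : 0 <= radial_integral r1 r2 (fun s => F s ^+ 2).
  by apply: (radial_integral_ge0 r2 r1_gt0) => s _; exact: sqr_ge0.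
have I2 : 0 <= radial_integral r1 r2 (grad_density F1).
  have D0 s : 0 < s -> 0 <= grad_density F1 s.
    by move=> s0; apply: mulr_ge0 => //; apply: mulr_ge0 (ltW s0) (sqr_ge0 _).
  exact: (radial_integral_ge0 r2 r1_gt0 D0).
rewrite -!EFin_expe -EFinD poweR_EFin powR12_sqrt ?sqr_sqrtr //.
by rewrite addr_ge0 ?sqr_ge0.
Qed.

End RadialNorms.

Section InfinityLimits.
Context {R : realType}.

Lemma cvg_sqrt_inv (f : R -> R) : {for 0, continuous f} ->
  (Num.sqrt (f alpha^-1))%:E @[alpha --> +oo] --> (Num.sqrt (f 0))%:E.
Proof.
move=> cf; apply: cvg_EFin; first by apply: nearW.
have inv0 : alpha^-1 @[alpha --> +oo] --> (0 : R).
  apply/(@gtr0_cvgV0 R R _ _ id); last exact: cvg_id.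
  exact: nbhs_pinfty_gt.
have fi : f alpha^-1 @[alpha --> +oo] --> f 0 by exact: (cvg_comp _ _ inv0 cf).
exact: (cvg_comp _ _ fi (@sqrt_continuous R (f 0))).
Qed.

Lemma cvg_pinfty_eq (f h : R -> \bar R) (l : \bar R) :
  (forall alpha, 0 < alpha -> f alpha = h alpha) ->
  h alpha @[alpha --> +oo] --> l -> f alpha @[alpha --> +oo] --> l.
Proof.
move=> fh; apply: cvg_trans; apply: near_eq_cvg; near=> alpha.
by apply/esym/fh; near: alpha; exact: nbhs_pinfty_gt.
Unshelve. all: by end_near. Qed.

End InfinityLimits.

Section Differences.
Context {R : realType}.
Variables (r1 r2 : R).
Hypotheses (r1_gt0 : 0 < r1) (r12 : r1 < r2).

Notation Omega := (annulus r1 r2).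
Notation area := (pi * (r2 ^+ 2 - r1 ^+ 2)).

Lemma norms_cst (v : R * R -> R) (k : R) :
    (forall x, Omega x -> v x = k) ->
  L2norm Omega v = (Num.sqrt (k ^+ 2 * area))%:E /\ H1norm Omega v = L2norm Omega v.
Proof.
move=> vk.
have L2E : L2norm Omega v = (Num.sqrt (k ^+ 2 * area))%:E.
  rewrite (L2norm_radial (F := fun=> k ^+ 2) r1_gt0 r12); last 2 first.
  - exact: continuous_pos_cst.
  - by move=> x xO; rewrite vk.
  by rewrite radial_integral_cst.
split => //; rewrite L2E.
rewrite (H1norm_radial r1_gt0 r12 (@profile_cst R k) vk) radial_integral_cst //.
rewrite (_ : grad_density _ = fun=> 0); last first.
  by apply/funext => s; rewrite /grad_density expr0n /= !mulr0.
by rewrite radial_integral_cst // mul0r addr0.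
Qed.

Variables (T T1 T2 : R -> R).
Hypothesis HT : profile T T1 T2.
Variables (A B C : R).

Notation G := (fun s => A * T s + B).
Notation I1 := (radial_integral r1 r2 G).
Notation I2 := (radial_integral r1 r2 (fun s => G s ^+ 2)).
Notation J := (radial_integral r1 r2 (grad_density T1)).

(** The squared norm of [G + A * C * t], expanded as a polynomial in [t]; the
    variable [t] stands for [1 / alpha], so limits at infinity become continuity
    at [0]. *)
Definition gap_sqnorm (t : R) : R :=
  I2 + (2 * A * C * t * I1 + (A * C * t) ^+ 2 * area).

Lemma continuous_pos_gap : continuous_pos G.
Proof.
have [cT _] := continuous_pos_profile HT.
by apply: continuous_posD; [apply: continuous_posM => //|]; exact: continuous_pos_cst.
Qed.

Lemma radial_integral_gap t :
  radial_integral r1 r2 (fun s => (t * (A * T s + (B + A * C * t))) ^+ 2) =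
  t ^+ 2 * gap_sqnorm t.
Proof.
have cG := continuous_pos_gap.
have cG2 : continuous_pos (fun s => G s ^+ 2) := continuous_posM cG cG.
have ct (c : R) : continuous_pos (fun=> c) by exact: continuous_pos_cst.
have cG1 (c : R) : continuous_pos (fun s => c * G s) := continuous_posM (ct c) cG.
have cG3 (c d : R) : continuous_pos (fun s => c * G s + d) :=
  continuous_posD (cG1 c) (ct d).
rewrite (_ : (fun s => _) = (fun s => t ^+ 2 *
  (G s ^+ 2 + (2 * A * C * t * G s + (A * C * t) ^+ 2)))); last first.
  by apply/funext => s; ring.
rewrite (radial_integralZ r1_gt0 r12 (t ^+ 2) (continuous_posD cG2 (cG3 _ _))).
rewrite (radial_integralD r1_gt0 r12 cG2 (cG3 _ _)).
rewrite (radial_integralD r1_gt0 r12 (cG1 _) (ct _)).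
by rewrite (radial_integralZ r1_gt0 r12 _ cG) (radial_integral_cst r1_gt0 r12).
Qed.

(** The form of [v] is that of [pa - p] with [t = 1 / alpha]. *)
Lemma norms_gap (v : R * R -> R) (t : R) :
    (forall x, Omega x -> v x = t * (A * T (sqn x) + (B + A * C * t))) ->
  L2norm Omega v = (Num.sqrt (t ^+ 2 * gap_sqnorm t))%:E /\
  H1norm Omega v = (Num.sqrt (t ^+ 2 * gap_sqnorm t + (t * A) ^+ 2 * J))%:E.
Proof.
move=> vE; have [_ cT1] := continuous_pos_profile HT.
have Hv := profileZ t (profileD (profileZ A HT) (profile_cst (B + A * C * t))).
have [cv _] := continuous_pos_profile Hv.
split.
  rewrite -radial_integral_gap; apply: L2norm_radial => //.
    exact: (continuous_posM cv cv).
  by move=> x xO; rewrite vE.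
rewrite (H1norm_radial r1_gt0 r12 Hv vE) /= radial_integral_gap.
rewrite (_ : grad_density _ = fun s => (t * A) ^+ 2 * grad_density T1 s).
  by rewrite (radial_integralZ r1_gt0 r12 _ (continuous_pos_grad_density cT1)).
by apply/funext => s; rewrite /grad_density /=; ring.
Qed.

Lemma gap_sqnorm_continuous : continuous gap_sqnorm.
Proof.
move=> t; rewrite /gap_sqnorm.
apply: cvgD; first exact: cvg_cst.
have lin (c : R) : (fun x : R => c * x) @ (t : R) --> c * t.
  by apply: cvgM; [exact: cvg_cst|exact: cvg_id].
apply: cvgD; apply: cvgM; try exact: cvg_cst; first exact: lin.
exact: (cvg_comp _ _ (lin _) (@exprn_continuous R 2 _)).
Qed.

Lemma gap_sqnorm0 : gap_sqnorm 0 = I2.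
Proof. by rewrite /gap_sqnorm !mulr0 mul0r expr0n /= mul0r !addr0. Qed.

Lemma H1gap_continuous :
  continuous (fun t : R => t ^+ 2 * gap_sqnorm t + (t * A) ^+ 2 * J).
Proof.
move=> t; have sq := @exprn_continuous R 2 t.
apply: cvgD; first by apply: cvgM => //; exact: gap_sqnorm_continuous.
apply: cvgM; last exact: cvg_cst.
have lin : (fun x : R => x * A) @ (t : R) --> t * A.
  by apply: cvgM; [exact: cvg_id|exact: cvg_cst].
exact: (cvg_comp _ _ lin (@exprn_continuous R 2 _)).
Qed.

(** If [G] has zero norm it vanishes on the annulus, and a nonconstant multiple
    of [T] cannot. *)
Lemma gap_norm0 : (forall s, 0 < s -> - (4 * (s * T2 s + T1 s)) = 1) ->
  Num.sqrt I2 = 0 -> A = 0 /\ B = 0.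
Proof.
move=> eT /eqP; rewrite sqrtr_eq0 => I2le.
have G2 s : 0 < s -> 0 <= G s ^+ 2 by rewrite sqr_ge0.
have I20 : I2 = 0.
  by apply/eqP; rewrite eq_le I2le (radial_integral_ge0 r2 r1_gt0 G2).
have cG2 : continuous_pos (fun s => G s ^+ 2) :=
  continuous_posM continuous_pos_gap continuous_pos_gap.
apply: (torsion_independent r1_gt0 r12 HT eT) => x xO.
have /eqP := radial_integral_eq0 r1_gt0 r12 cG2 G2 I20 xO.
by rewrite expf_eq0 /= => /eqP.
Qed.

End Differences.

(** * Identification of the states and adjoint states *)

Section Comparison.
Context {R : realType}.
Variables (r1 r2 : R).
Hypotheses (r1_gt0 : 0 < r1) (r12 : r1 < r2).
Variables (g q b zd : R).

Notation U := (state_profile r1 r2 g q b).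
Notation U1 := (state_profile1 r2 g q).
Notation U2 := (state_profile2 r2 g q).
Notation A := (2 * r1 * U1 (r1 ^+ 2)).

Lemma state_unique u : state r1 r2 g q b u ->
  forall x, closed_annulus r1 r2 x -> u x = U (sqn x).
Proof.
case=> pu iu ou; have [HU eU iU oU _] := state_profileP r1_gt0 r12 g q b.
apply: (mixed_radial r1_gt0 r12 (c := b) HU pu ou _ oU); last by left.
by move=> x xO; apply: eU; exact: (annulus_sqn_gt0 r1_gt0 xO).
Qed.

(** The inner flux [A] of the limit state is what the Robin term must absorb,
    which shifts the state by the constant [A / alpha]. *)
Lemma state_robin_unique alpha u : 0 < alpha ->
    state_robin r1 r2 g q b alpha u ->
  forall x, closed_annulus r1 r2 x -> u x = U (sqn x) + A / alpha.
Proof.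
move=> a0 [pu iu ou]; have [HU eU iU oU _] := state_profileP r1_gt0 r12 g q b.
have HF := profileD HU (@profile_cst R (A / alpha)).
apply: (mixed_radial r1_gt0 r12 (c := b) HF pu ou).
- move=> x xO; rewrite /= !addr0; apply: eU.
  exact: (annulus_sqn_gt0 r1_gt0 xO).
- by rewrite /= addr0.
- right; exists alpha => //; split => //=.
  by rewrite iU addr0; field; rewrite gt_eqF.
Qed.

Variables (P P1 P2 : R -> R).
Hypotheses (HP : profile P P1 P2)
  (eP : forall s, 0 < s -> - (4 * (s * P2 s + P1 s)) = U s - zd)
  (iP : P (r1 ^+ 2) = 0) (oP : P1 (r2 ^+ 2) = 0).
Variables (T T1 T2 : R -> R).
Hypotheses (HT : profile T T1 T2)
  (eT : forall s, 0 < s -> - (4 * (s * T2 s + T1 s)) = 1)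
  (iT : T (r1 ^+ 2) = 0) (oT : T1 (r2 ^+ 2) = 0).

Notation B := (2 * r1 * P1 (r1 ^+ 2)).
Notation C := (2 * r1 * T1 (r1 ^+ 2)).

Lemma adjoint_unique u p : state r1 r2 g q b u -> adjoint r1 r2 zd u p ->
  forall x, closed_annulus r1 r2 x -> p x = P (sqn x).
Proof.
move=> su [pp ip op]; have uE := state_unique su.
apply: (mixed_radial r1_gt0 r12 (c := 0) HP pp op); last by left.
- move=> x xO; rewrite (uE _ (annulus_sub_closed xO)).
  by apply: eP; exact: (annulus_sqn_gt0 r1_gt0 xO).
- by rewrite oP mulr0 oppr0.
Qed.

(** The source exceeds the one of the limit problem by [A / alpha], which [T]
    absorbs, and the remaining constant makes the Robin condition hold at
    [r = r1], where [P] and [T] vanish. *)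
Lemma adjoint_robin_unique alpha u p : 0 < alpha ->
    state_robin r1 r2 g q b alpha u -> adjoint_robin r1 r2 zd alpha u p ->
  forall x, closed_annulus r1 r2 x ->
    p x = P (sqn x) + alpha^-1 * (A * T (sqn x) + (B + A * C * alpha^-1)).
Proof.
move=> a0 su [pp ip op]; have uE := state_robin_unique a0 su.
have HF := profileD HP (profileZ alpha^-1
  (profileD (profileZ A HT) (profile_cst (B + A * C * alpha^-1)))).
apply: (mixed_radial r1_gt0 r12 (c := 0) HF pp op).
- move=> x xO; rewrite (uE _ (annulus_sub_closed xO)) /=.
  have x0 := annulus_sqn_gt0 r1_gt0 xO.
  have := eP x0; have := eT x0.
  move: (P2 _) (P1 (sqn x)) (T2 _) (T1 (sqn x)) (U _) => p2 p1 t2 t1 w tE wE.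
  transitivity (- (4 * (sqn x * p2 + p1)) +
      A / alpha * (- (4 * (sqn x * t2 + t1)))); first by ring.
  by rewrite tE wE; ring.
- by rewrite /= oP oT mulr0 !addr0 mulr0 addr0 mulr0 oppr0.
- right; exists alpha => //; split => //=.
  by rewrite iP iT; field; rewrite gt_eqF.
Qed.

End Comparison.

Theorem mainTheorem8 (R : realType) (r1 r2 g q b zd : R)
    (r1_gt0 : 0 < r1) (r12 : r1 < r2) :
  let Omega := annulus r1 r2 in
  exists K2 L2 : R,
    [/\ K2 = Num.sqrt pi * Num.sqrt (r2 ^+ 2 - r1 ^+ 2)
               * `|2 * q * r2 - g * (r2 ^+ 2 - r1 ^+ 2)| / (2 * r1),
        0 <= K2, 0 <= L2,
        2 * q * r2 != g * (r2 ^+ 2 - r1 ^+ 2) -> 0 < K2 /\ 0 < L2 &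
        forall (u p : R * R -> R) (ua pa : R -> R * R -> R),
          state r1 r2 g q b u ->
          adjoint r1 r2 zd u p ->
          (forall alpha, 0 < alpha ->
             state_robin r1 r2 g q b alpha (ua alpha)) ->
          (forall alpha, 0 < alpha ->
             adjoint_robin r1 r2 zd alpha (ua alpha) (pa alpha)) ->
          [/\ H1norm Omega (ua alpha \- u) @[alpha --> +oo] --> 0%E,
              H1norm Omega (pa alpha \- p) @[alpha --> +oo] --> 0%E,
              (forall alpha, 0 < alpha ->
                 H1norm Omega (ua alpha \- u) = L2norm Omega (ua alpha \- u) /\
                 L2norm Omega (ua alpha \- u) = (K2 / alpha)%:E),
              (alpha%:E * L2norm Omega (pa alpha \- p)%R)%E
                @[alpha --> +oo] --> L2%:E &
              0 < L2 <->
                exists2 alpha, 0 < alpha &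
                  exists2 x, Omega x & pa alpha x != p x]].
Proof.
move=> Omega.
have r2_gt0 := lt_trans r1_gt0 r12.
have D0 : 0 < r2 ^+ 2 - r1 ^+ 2 by rewrite subr_gt0 ltr_pXn2r ?nnegrE ?ltW.
pose A := 2 * r1 * state_profile1 r2 g q (r1 ^+ 2).
have [_ _ _ _ AE] := state_profileP r1_gt0 r12 g q b; rewrite -/A in AE.
have [P [P1 [P2 [HP eP iP oP]]]] := adjoint_profile_exists r1_gt0 r12 g q b zd.
have [T [T1 [T2 [HT eT iT oT]]]] := torsion_profile_exists r1_gt0 r12.
pose B := 2 * r1 * P1 (r1 ^+ 2).
pose C := 2 * r1 * T1 (r1 ^+ 2).
pose I2 := radial_integral r1 r2 (fun s => (A * T s + B) ^+ 2).
pose K2 := Num.sqrt pi * Num.sqrt (r2 ^+ 2 - r1 ^+ 2)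
               * `|2 * q * r2 - g * (r2 ^+ 2 - r1 ^+ 2)| / (2 * r1).
have K2E : K2 = `|A| * Num.sqrt (pi * (r2 ^+ 2 - r1 ^+ 2)).
  rewrite AE normrN normf_div (gtr0_norm (mulr_gt0 _ r1_gt0)) //.
  by rewrite sqrtrM ?pi_ge0 // /K2; ring.
have L2_eq0 : Num.sqrt I2 = 0 -> A = 0 /\ B = 0 := gap_norm0 r1_gt0 r12 HT eT.
have L2_ge0 : 0 <= Num.sqrt I2 by exact: sqrtr_ge0.
have L2_gt0 : A != 0 -> 0 < Num.sqrt I2.
  move=> An0; rewrite lt_neqAle L2_ge0 andbT eq_sym.
  by apply: contra_neq An0 => /L2_eq0[].
exists K2, (Num.sqrt I2); split => //.
- by rewrite K2E mulr_ge0 ?sqrtr_ge0.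
- move=> neq.
  have An0 : A != 0.
    by rewrite AE oppr_eq0 mulf_neq0 ?invr_eq0 ?subr_eq0 // mulf_neq0 ?gt_eqF.
  split; last exact: L2_gt0.
  by rewrite K2E mulr_gt0 ?normr_gt0 // sqrtr_gt0 mulr_gt0 ?pi_gt0.
move=> u p ua pa su ap sua apa.
have dU alpha x : 0 < alpha -> Omega x -> (ua alpha \- u) x = A / alpha.
  move=> a0 /annulus_sub_closed xA.
  rewrite /= (state_robin_unique r1_gt0 r12 a0 (sua _ a0) xA).
  by rewrite (state_unique r1_gt0 r12 su xA) addrC addKr.
have dP alpha x : 0 < alpha -> Omega x -> (pa alpha \- p) x =
    alpha^-1 * (A * T (sqn x) + (B + A * C * alpha^-1)).
  move=> a0 /annulus_sub_closed xA.
  rewrite /= (adjoint_robin_unique r1_gt0 r12 HP eP iP oP HT eT iT oT a0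
    (sua _ a0) (apa _ a0) xA).
  by rewrite (adjoint_unique r1_gt0 r12 HP eP iP oP su ap xA) addrC addKr.
have nU alpha : 0 < alpha ->
    H1norm Omega (ua alpha \- u) = L2norm Omega (ua alpha \- u) /\
    L2norm Omega (ua alpha \- u) = (K2 / alpha)%:E.
  move=> a0; have [L2E H1E] := norms_cst r1_gt0 r12 (fun x => @dU alpha x a0).
  split; first exact: H1E.
  rewrite L2E sqrtrM ?sqr_ge0 // sqrtr_sqr K2E normrM.
  by rewrite [`|alpha^-1|]gtr0_norm ?invr_gt0 // mulrAC.
have nP alpha (a0 : 0 < alpha) := norms_gap r1_gt0 r12 HT (fun x => @dP alpha x a0).
split => //.
- apply: (@cvg_pinfty_eq _ _ (fun alpha => (Num.sqrt ((K2 * alpha^-1) ^+ 2))%:E)).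
    move=> alpha a0; have [-> ->] := nU _ a0.
    by rewrite sqrtr_sqr ger0_norm // K2E
      mulr_ge0 ?invr_ge0 ?(ltW a0) // mulr_ge0 ?sqrtr_ge0.
  have cf : {for 0, continuous (fun t : R => (K2 * t) ^+ 2)}.
    have lin : (fun t : R => K2 * t) @ (0 : R) --> K2 * 0.
      by apply: cvgM; [exact: cvg_cst|exact: cvg_id].
    exact: (cvg_comp _ _ lin (@exprn_continuous R 2 _)).
  by have := cvg_sqrt_inv cf; rewrite mulr0 expr0n sqrtr0.
- apply: cvg_pinfty_eq (fun alpha a0 => (nP alpha a0).2) _.
  have := cvg_sqrt_inv (@H1gap_continuous R r1 r2 T T1 A B C 0).
  by rewrite mul0r !expr0n /= !mul0r addr0 sqrtr0.
- apply: (@cvg_pinfty_eq _ _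
    (fun alpha => (Num.sqrt (gap_sqnorm r1 r2 T A B C alpha^-1))%:E)).
    move=> alpha a0; rewrite (nP _ a0).1 -EFinM; congr EFin.
    rewrite sqrtrM ?sqr_ge0 // sqrtr_sqr gtr0_norm ?invr_gt0 //.
    by rewrite mulVKf ?gt_eqF.
  have := cvg_sqrt_inv (@gap_sqnorm_continuous R r1 r2 T A B C 0).
  by rewrite gap_sqnorm0.
- split=> [L2pos|[alpha a0 [x xO]]].
    apply: contrapT => noex.
    (* This is [pa 1 - p]; its vanishing forces [A] and then [B] to be zero. *)
    have zero x : Omega x -> A * T (sqn x) + (B + A * C) = 0.
      move=> xO; apply: contrapT => neq; apply: noex.
      exists 1 => //; exists x => //.
      rewrite -subr_eq0; have /= -> := dP 1 x ltr01 xO.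
      by rewrite invr1 mulr1 mul1r; apply/eqP.
    have [A0 BC0] := torsion_independent r1_gt0 r12 HT eT zero.
    have B0 : B = 0 by rewrite -BC0 A0 mul0r addr0.
    move: L2pos; rewrite /I2 A0 B0 (_ : (fun s => _) = fun=> 0).
      by rewrite (radial_integral_cst r1_gt0 r12) mul0r sqrtr0 ltxx.
    by apply/funext => s; rewrite mul0r addr0 expr0n.
  apply: contraNT; rewrite -leNgt => L2le.
  have [A0 B0] : A = 0 /\ B = 0 by apply: L2_eq0; apply/eqP; rewrite eq_le L2le.
  rewrite -subr_eq0; have /= -> := dP alpha x a0 xO.
  by rewrite A0 B0 !mul0r !addr0 mulr0.
Qed.
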